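(* Let $n\ge 4$. Denote by $V$ the standard $(n-1)$-dimensional irreducible complex representation of the symmetric group $\Sigma_n$ and by $W$ the irreducible complex representation of $\Sigma_n$ corresponding to the partition $(n-2,2)$ of $n$. Then, as representations of $\Sigma_n$, $$\rho_n(1)\cong V\oplus \bigwedge\nolimits^2 V\oplus W.$$ Also, for $n=3$, with $V$ the standard $2$-dimensional representation of $\Sigma_3$, one has $\rho_3(1)\cong V\oplus\bigwedge^2 V$.
   Context: $B_n$ is the braid group on $n$ strings with standard generators $\sigma_1,\dots,\sigma_{n-1}$, and $P_n\subset B_n$ is the subgroup of pure braids, so $B_n/P_n\cong\Sigma_n$ with $\sigma_i\mapsto (i\;\,i+1)$. The reduced Burau representation $\beta_n:B_n\to GL_{n-1}(\mathbb{Z}[t,t^{-1}])$: $\beta_n(\sigma_r)$ is the matrix that agrees with the identity matrix except in row $r$, where the entries are: $t$ in column $r-1$ (if $r\ge 2$), $-t$ in column $r$, $1$ in column $r+1$ (if $r\le n-2$), and $0$ elsewhere. For $\alpha\in\mathbb{C}^\times$ and $i\ge1$ let $K^i(\alpha)=\{A\in SL_{n-1}(\mathbb{C}[t,t^{-1}]) : A\equiv I \bmod (t-\alpha)^i\}$ and $K(\alpha)=K^1(\alpha)$. Writing $A\in K(\alpha)$ as $A\equiv I+(t-\alpha)Y \bmod (t-\alpha)^2$ with $Y$ a complex matrix, the map $A\mapsto Y$ induces an isomorphism $K(\alpha)/K^2(\alpha)\cong \mathfrak{sl}_{n-1}(\mathbb{C})$, a complex vector space of dimension $n(n-2)$. The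 conjugation action of $GL_{n-1}(\mathbb{C}[t,t^{-1}])$ on $K(\alpha)$ (a matrix $g$ sends $A$ to $gAg^{-1}$) induces a homomorphism $f_n(\alpha):GL_{n-1}(\mathbb{C}[t,t^{-1}])\to \mathrm{Aut}(K(\alpha)/K^2(\alpha))\cong GL_{n(n-2)}(\mathbb{C})$, and $\rho_n(\alpha)=f_n(\alpha)\circ\beta_n : B_n\to GL_{n(n-2)}(\mathbb{C})$. For $\alpha=1$ the kernel of $\rho_n(1)$ is $P_n$, and $\rho_n(1)$ is thereby regarded as a complex representation of $\Sigma_n=B_n/P_n$. *)

(* Defs.v *)
From HB Require Import structures.
From mathcomp Require Import all_boot all_order all_algebra all_fingroup.
From mathcomp Require Import mxrepresentation character.
From mathcomp Require Import boolp classical_sets reals.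
From mathcomp Require Import complex.
From mathcomp Require Import ring zify.

Set Implicit Arguments.
Unset Strict Implicit.
Unset Printing Implicit Defensive.

Import GRing.Theory.
Local Open Scope ring_scope.
Local Open Scope quotient_scope.

(* D[t, t^-1] is realised inside the fraction field of D[t], as the set of
   the x such that t ^ k * x is a polynomial for some k. *)
Section Laurent.
Variable D : idomainType.
Local Notation K := {fraction {poly D}}.
Local Notation "p %:F" := (@FracField.tofrac {poly D} p).

Definition is_laurent : {pred K} :=
  fun x => `[< exists k (p : {poly D}), ('X^k)%:F * x = p%:F >].

Lemma is_laurentP x :
  reflect (exists k (p : {poly D}), ('X^k)%:F * x = p%:F) (x \in is_laurent).
Proof. exact: asboolP. Qed.

Lemma is_laurent_subring : subring_closed is_laurent.
Proof.
split.
- by apply/is_laurentP; exists 0, 1; rewrite expr0 mulr1.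
- move=> x y /is_laurentP[k [p kp]] /is_laurentP[l [q lq]].
  apply/is_laurentP; exists (k + l), ('X^l * p - 'X^k * q).
  by rewrite exprD tofracB !tofracM -kp -lq mulrBr !mulrA [_%:F * 'X^k%:F]mulrC.
- move=> x y /is_laurentP[k [p kp]] /is_laurentP[l [q lq]].
  apply/is_laurentP; exists (k + l), (p * q).
  by rewrite exprD !tofracM -kp -lq mulrACA.
Qed.

HB.instance Definition _ :=
  GRing.isSubringClosed.Build K is_laurent is_laurent_subring.

Record laurent := Laurent { lval : K; lvalP : lval \in is_laurent }.

HB.instance Definition _ := [isSub for lval].
HB.instance Definition _ := [Choice of laurent by <:].
HB.instance Definition _ := [SubChoice_isSubComNzRing of laurent by <:].

Definition laurent_unit : {pred laurent} :=
  fun x => (lval x != 0) && ((lval x)^-1 \in is_laurent).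
Definition laurent_inv (x : laurent) : laurent :=
  if x \in laurent_unit then insubd x (lval x)^-1 else x.

Lemma laurent_mulVx : {in laurent_unit, left_inverse 1 laurent_inv *%R}.
Proof.
move=> x ux; rewrite /laurent_inv ux; case/andP: ux => x0 xV.
apply: val_inj; rewrite rmorphM rmorph1 /= val_insubd /= xV.
by rewrite mulVf.
Qed.

Lemma laurent_unitPl x y : y * x = 1 -> laurent_unit x.
Proof.
move=> /(congr1 val); rewrite rmorphM rmorph1 /= => yx.
have x0 : lval x != 0.
  by apply/eqP => x0; move: yx; rewrite x0 mulr0 => /eqP; rewrite eq_sym oner_eq0.
rewrite /laurent_unit /= x0 /=.
have -> : (lval x)^-1 = lval y by apply: (mulIf x0); rewrite mulVf.
exact: lvalP.
Qed.

Lemma laurent_invr_out : {in [predC laurent_unit], laurent_inv =1 id}.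
Proof. by move=> x; rewrite inE /laurent_inv => /negbTE ->. Qed.

HB.instance Definition _ := GRing.ComNzRing_hasMulInverse.Build laurent
  laurent_mulVx laurent_unitPl laurent_invr_out.

Lemma laurent_idomain : GRing.integral_domain_axiom laurent.
Proof.
move=> x y /(congr1 val); rewrite rmorphM rmorph0 /= => /eqP.
by rewrite mulf_eq0 => /orP[] /eqP xy0; apply/orP; [left|right]; apply/eqP/val_inj.
Qed.

HB.instance Definition _ := GRing.ComUnitRing_isIntegral.Build laurent
  laurent_idomain.

Lemma polyF_laurent (p : {poly D}) : p%:F \in is_laurent.
Proof. by apply/is_laurentP; exists 0, p; rewrite expr0 mul1r. Qed.

Definition laurent_poly (p : {poly D}) : laurent := Laurent (polyF_laurent p).
Definition laurentC (c : D) : laurent := laurent_poly c%:P.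
Definition laurentX : laurent := laurent_poly 'X.

Lemma laurent_poly_is_zmod : zmod_morphism laurent_poly.
Proof. by move=> p q; apply: val_inj; rewrite rmorphB /= tofracB. Qed.
Lemma laurent_poly_is_monoid : monoid_morphism laurent_poly.
Proof.
split=> [|p q]; apply: val_inj; first by rewrite rmorph1 /= tofrac1.
by rewrite rmorphM /= tofracM.
Qed.
HB.instance Definition _ :=
  GRing.isZmodMorphism.Build _ _ laurent_poly laurent_poly_is_zmod.
HB.instance Definition _ :=
  GRing.isMonoidMorphism.Build _ _ laurent_poly laurent_poly_is_monoid.

Lemma laurentC_is_zmod : zmod_morphism laurentC.
Proof. by move=> p q; rewrite /laurentC !rmorphB. Qed.
Lemma laurentC_is_monoid : monoid_morphism laurentC.
Proof. by split=> [|p q]; rewrite /laurentC ?rmorph1 ?rmorphM. Qed.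
HB.instance Definition _ :=
  GRing.isZmodMorphism.Build _ _ laurentC laurentC_is_zmod.
HB.instance Definition _ :=
  GRing.isMonoidMorphism.Build _ _ laurentC laurentC_is_monoid.

Lemma laurent_poly_inj : injective laurent_poly.
Proof. by move=> p q /(congr1 val) /= /eqP; rewrite tofrac_eq => /eqP. Qed.

Lemma laurentP (x : laurent) :
  exists k (p : {poly D}), laurentX ^+ k * x = laurent_poly p.
Proof.
have /is_laurentP[k [p kp]] := lvalP x; exists k, p; apply: val_inj.
by rewrite rmorphM rmorphXn /= -kp tofracXn.
Qed.

Lemma laurentX_unit : laurentX \is a GRing.unit.
Proof.
have X0 : ('X : {poly D})%:F != 0 by rewrite tofrac_eq0 polyX_eq0.
apply/andP; split => //; apply/is_laurentP; exists 1, 1.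
by rewrite expr1 mulfV.
Qed.

End Laurent.

Arguments laurentX {D}.

Section GeneralLinear.
Variables (A : comUnitRingType) (m : nat).

Definition GL := {g : 'M[A]_m | g \in unitmx}.

Definition GLone : GL := Sub 1%:M (unitmx1 A m).
Definition GLmul (g h : GL) : GL :=
  Sub (val g *m val h)
    (eq_ind_r is_true (introT andP (conj (valP g) (valP h))) (unitmx_mul _ _)).
Definition GLinv (g : GL) : GL :=
  Sub (invmx (val g)) (eq_ind_r is_true (valP g) (unitmx_inv _)).

Lemma GLmulA : associative GLmul.
Proof. by move=> f g h; apply: val_inj; rewrite /= mulmxA. Qed.
Lemma GLmul1 : left_id GLone GLmul.
Proof. by move=> g; apply: val_inj; rewrite /= mul1mx. Qed.
Lemma GLmulr1 : right_id GLone GLmul.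
Proof. by move=> g; apply: val_inj; rewrite /= mulmx1. Qed.
Lemma GLmulV : left_inverse GLone GLinv GLmul.
Proof. by move=> g; apply: val_inj; rewrite /= mulVmx ?(valP g). Qed.
Lemma GLmulrV : right_inverse GLone GLinv GLmul.
Proof. by move=> g; apply: val_inj; rewrite /= mulmxV ?(valP g). Qed.

HB.instance Definition _ := Choice.on GL.
HB.instance Definition _ :=
  isGroup.Build GL GLmulA GLmul1 GLmulr1 GLmulV GLmulrV.

Lemma GLvalM (g h : GL) : val (g * h)%g = val g *m val h.
Proof. by []. Qed.
Lemma GLval1 : val (1%g : GL) = 1%:M.
Proof. by []. Qed.
Lemma GLvalV (g : GL) : val (g^-1)%g = invmx (val g).
Proof. by []. Qed.

End GeneralLinear.

Local Notation qrepr := generic_quotient.repr.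

Section Braid.
Variable n : nat.

(* The letters (i, true) and (i, false) are the generator sigma_(i+1) and its
   inverse; a word is read as the product of its letters, from left to right. *)
Definition braid_word := seq ('I_n.-1 * bool).
Local Notation sg i := (i, true).

Inductive braid_equiv : braid_word -> braid_word -> Prop :=
| BraidRefl w : braid_equiv w w
| BraidSym v w : braid_equiv v w -> braid_equiv w v
| BraidTrans u v w : braid_equiv u v -> braid_equiv v w -> braid_equiv u w
| BraidCat v v' w w' :
    braid_equiv v v' -> braid_equiv w w' -> braid_equiv (v ++ w) (v' ++ w')
| BraidInv i b : braid_equiv [:: (i, b); (i, ~~ b)] [::]
| BraidFar (i j : 'I_n.-1) : (i.+1 < j)%N ->
    braid_equiv [:: sg i; sg j] [:: sg j; sg i]
| BraidNear (i j : 'I_n.-1) : j = i.+1 :> nat ->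
    braid_equiv [:: sg i; sg j; sg i] [:: sg j; sg i; sg j].

Definition braid_rel : rel braid_word := fun v w => `[< braid_equiv v w >].

Lemma braid_relP v w : reflect (braid_equiv v w) (braid_rel v w).
Proof. exact: asboolP. Qed.

Lemma braid_rel_refl : reflexive braid_rel.
Proof. by move=> w; apply/braid_relP/BraidRefl. Qed.
Lemma braid_rel_sym : symmetric braid_rel.
Proof. by move=> v w; apply/braid_relP/braid_relP; apply: BraidSym. Qed.
Lemma braid_rel_trans : transitive braid_rel.
Proof.
by move=> v u w /braid_relP uv /braid_relP vw; apply/braid_relP/(BraidTrans uv).
Qed.

Canonical braid_equiv_rel :=
  EquivRel braid_rel braid_rel_refl braid_rel_sym braid_rel_trans.

Definition braid := {eq_quot braid_rel}.

HB.instance Definition _ : EqQuotient _ braid_rel braid :=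
  EqQuotient.on braid.
HB.instance Definition _ := Choice.on braid.

Lemma braid_eqP v w : braid_equiv v w <-> \pi_braid v = \pi_braid w.
Proof.
split=> [vw|/eqmodP/braid_relP //].
by apply/eqmodP/braid_relP.
Qed.

Lemma braidW (P : braid -> Prop) : (forall w, P (\pi_braid w)) -> forall x, P x.
Proof. by move=> Pw x; rewrite -[x]reprK; apply: Pw. Qed.

Lemma braid_equiv_repr w : braid_equiv (qrepr (\pi_braid w)) w.
Proof. by apply/braid_eqP; rewrite reprK. Qed.

Definition word_inv (w : braid_word) : braid_word :=
  rev [seq (x.1, ~~ x.2) | x <- w].

Lemma word_inv_cat v w : word_inv (v ++ w) = word_inv w ++ word_inv v.
Proof. by rewrite /word_inv map_cat rev_cat. Qed.

Lemma word_invK : involutive word_inv.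
Proof.
move=> w; rewrite /word_inv map_rev revK -map_comp map_id_in //.
by move=> [i b] _ /=; rewrite negbK.
Qed.

Lemma word_mulV w : braid_equiv (w ++ word_inv w) [::].
Proof.
elim: w => [|[i b] w IH]; first exact: BraidRefl.
rewrite -[_ :: w]/([:: (i, b)] ++ w) word_inv_cat catA -[X in X ++ _]catA.
apply: (BraidTrans (v := ([:: (i, b)] ++ [::]) ++ [:: (i, ~~ b)])).
  by do 2?apply: BraidCat => //; apply: BraidRefl.
exact: BraidInv.
Qed.

Lemma word_Vmul w : braid_equiv (word_inv w ++ w) [::].
Proof. by have := word_mulV (word_inv w); rewrite word_invK. Qed.

Definition braid1 : braid := \pi_braid [::].
Definition braidM (x y : braid) : braid := \pi_braid (qrepr x ++ qrepr y).
Definition braidV (x : braid) : braid := \pi_braid (word_inv (qrepr x)).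

Lemma pi_braidM v w : braidM (\pi_braid v) (\pi_braid w) = \pi_braid (v ++ w).
Proof. by apply/braid_eqP; apply: BraidCat; apply: braid_equiv_repr. Qed.

Lemma braidMA : associative braidM.
Proof.
elim/braidW=> u; elim/braidW=> v; elim/braidW=> w.
by rewrite !pi_braidM catA.
Qed.
Lemma braid1M : left_id braid1 braidM.
Proof. by elim/braidW=> w; rewrite pi_braidM. Qed.
Lemma braidM1 : right_id braid1 braidM.
Proof. by elim/braidW=> w; rewrite pi_braidM cats0. Qed.
Lemma braidVM : left_inverse braid1 braidV braidM.
Proof.
move=> x; rewrite -[X in braidM _ X]reprK pi_braidM.
exact/braid_eqP/word_Vmul.
Qed.
Lemma braidMV : right_inverse braid1 braidV braidM.
Proof.
move=> x; rewrite -[X in braidM X _]reprK pi_braidM.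
exact/braid_eqP/word_mulV.
Qed.

HB.instance Definition _ := isGroup.Build braid braidMA braid1M braidM1 braidVM braidMV.

Definition sigma (i : 'I_n.-1) : braid := \pi_braid [:: (i, true)].

(* The homomorphism sending sigma_i to s i, provided that the s i satisfy the
   braid relations. *)
Section Lift.
Variables (G : groupType) (s : 'I_n.-1 -> G).

Definition word_eval (w : braid_word) : G :=
  (\prod_(x <- w) (if x.2 then s x.1 else (s x.1)^-1))%g.

Definition braid_lift (b : braid) : G := word_eval (qrepr b).

Definition braid_relations : Prop :=
  (forall i j : 'I_n.-1, (i.+1 < j)%N -> s i * s j = s j * s i)%g /\
  (forall i j : 'I_n.-1, j = i.+1 :> nat ->
     s i * s j * s i = s j * s i * s j)%g.

Hypothesis srel : braid_relations.

Lemma word_eval_cat v w : word_eval (v ++ w) = (word_eval v * word_eval w)%g.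
Proof. by rewrite /word_eval big_cat. Qed.

Lemma word_eval_equiv v w : braid_equiv v w -> word_eval v = word_eval w.
Proof.
case: srel => far near; elim=> {v w} //.
- by move=> u v w _ -> _ ->.
- by move=> v v' w w' _ vv' _ ww'; rewrite !word_eval_cat vv' ww'.
- move=> i b; rewrite /word_eval !big_cons big_nil mulg1.
  by case: b; rewrite ?mulgV ?mulVg.
- by move=> i j ij; rewrite /word_eval !big_cons !big_nil !mulg1; apply: far.
- move=> i j ij; rewrite /word_eval !big_cons !big_nil !mulg1 !mulgA.
  exact: near.
Qed.

Lemma braid_lift_pi w : braid_lift (\pi_braid w) = word_eval w.
Proof. exact/word_eval_equiv/braid_equiv_repr. Qed.

Lemma braid_liftM : {morph braid_lift : x y / (x * y)%g}.
Proof.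
elim/braidW=> v; elim/braidW=> w.
by rewrite -[X in braid_lift X]/(braidM _ _) pi_braidM !braid_lift_pi word_eval_cat.
Qed.

Lemma braid_lift1 : braid_lift 1%g = 1%g.
Proof. by rewrite braid_lift_pi /word_eval big_nil. Qed.

Lemma braid_lift_sigma i : braid_lift (sigma i) = s i.
Proof. by rewrite braid_lift_pi /word_eval big_seq1. Qed.

End Lift.

Lemma braid_sigma_ind (P : braid -> Prop) :
    P 1%g -> (forall i x, P x -> P (sigma i * x)%g) ->
    (forall i x, P x -> P ((sigma i)^-1 * x)%g) -> forall x, P x.
Proof.
move=> P1 PM PV; elim/braidW; elim=> [//|[i b] w IH].
rewrite -cat1s -pi_braidM.
case: b; first exact: PM.
suff -> : \pi_braid [:: (i, false)] = ((sigma i)^-1)%g :> braid by exact: PV.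
apply: (mulgI (sigma i)); rewrite mulgV.
by rewrite [LHS](pi_braidM [:: (i, true)]); apply/braid_eqP; apply: BraidInv.
Qed.

End Braid.

Section BraidPerm.
Variable n : nat.

Lemma ord_pred_ltS (i : 'I_n.-1) : (i.+1 < n)%N.
Proof. by have := ltn_ord i; rewrite ltn_predRL. Qed.

Definition adj_tperm (i : 'I_n.-1) : 'S_n :=
  tperm (Ordinal (ltnW (ord_pred_ltS i))) (Ordinal (ord_pred_ltS i)).

Lemma adj_tperm_relations : braid_relations adj_tperm.
Proof.
pose lo (i : 'I_n.-1) := Ordinal (ltnW (ord_pred_ltS i)).
pose hi (i : 'I_n.-1) := Ordinal (ord_pred_ltS i).
have invJ (a b : 'I_n) (u : 'S_n) :
    (tperm a b * u * tperm a b = u ^ tperm a b)%g.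
  by rewrite conjgE tpermV mulgA.
split=> i j ij; rewrite /adj_tperm -/(lo i) -/(lo j) -/(hi i) -/(hi j).
  have Dlo : lo i != lo j by rewrite -val_eqE /= neq_ltn (ltnW ij).
  have Dhi : hi i != hi j by rewrite -val_eqE /= eqSS neq_ltn (ltnW ij).
  have Dlh : lo i != hi j by rewrite -val_eqE /= neq_ltn ltnS ltnW // ltnW.
  have Dhl : hi i != lo j by rewrite -val_eqE /= neq_ltn ij.
  by apply/commgP/conjg_fixP; rewrite tpermJ !tpermD // eq_sym.
have lohi : lo j = hi i by apply: val_inj.
have Dlh : lo i != hi i by rewrite -val_eqE /= neq_ltn leqnn.
have Dhh : hi j != hi i by rewrite -val_eqE /= ij eqSS neq_ltn leqnn orbT.
have Dll : lo i != hi j by rewrite -val_eqE /= ij neq_ltn ltnS leqnSn.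
by rewrite !invJ !tpermJ lohi tpermR !tpermL !tpermD // eq_sym.
Qed.

Definition braid_perm : braid n -> 'S_n := braid_lift adj_tperm.

Lemma braid_permM x y : braid_perm (x * y)%g = (braid_perm x * braid_perm y)%g.
Proof. exact: (braid_liftM adj_tperm_relations). Qed.
Lemma braid_perm1 : braid_perm 1%g = 1%g.
Proof. exact: (braid_lift1 adj_tperm_relations). Qed.
Lemma braid_perm_sigma i : braid_perm (sigma i) = adj_tperm i.
Proof. exact: (braid_lift_sigma adj_tperm_relations). Qed.

(* Hence 'S_n is the quotient of the braid group by the kernel of [braid_perm],
   which is the group of pure braids. *)
Lemma braid_perm_surj (g : 'S_n) : exists b, braid_perm b = g.
Proof.
pose P (g : 'S_n) := exists b, braid_perm b = g.
have P1 : P 1%g by exists 1%g; apply: braid_perm1.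
have PM x y : P x -> P y -> P (x * y)%g.
  by move=> [b <-] [c <-]; exists (b * c)%g; apply: braid_permM.
have Padj (i j : 'I_n) : j = i.+1 :> nat -> P (tperm i j).
  move=> ij; have ip : (i < n.-1)%N by rewrite ltn_predRL -ij.
  exists (sigma (Ordinal ip)); rewrite braid_perm_sigma /adj_tperm.
  by congr tperm; apply: val_inj.
have Plt k (i j : 'I_n) : j = (i + k.+1)%N :> nat -> P (tperm i j).
  elim: k j => [|k IH] j ij; first by apply: Padj; rewrite ij addn1.
  have lp : (i + k.+1 < n)%N by have := ltn_ord j; rewrite ij addnS; apply: ltnW.
  pose l := Ordinal lp.
  have Pl : P (tperm l j) by apply: Padj; rewrite ij addnS.
  have -> : tperm i j = (tperm l j * (tperm i l * tperm l j))%g.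
    rewrite -{1}(tpermV l j) -conjgE tpermJ tpermL tpermD // -val_eqE /=; lia.
  by apply: (PM) => //; apply: (PM) => //; apply: IH.
have Pt (i j : 'I_n) : P (tperm i j).
  have [ij|ji|/val_inj <-] := ltngtP i j; last by rewrite tperm1.
    by apply: (@Plt (j - i.+1)%N); lia.
  by rewrite tpermC; apply: (@Plt (i - j.+1)%N); lia.
have [ts -> _] := prod_tpermP g.
by apply: (big_ind P) => // t _; apply: Pt.
Qed.

End BraidPerm.

Lemma far_mx (R : comNzRingType) m (x y : 'M[R]_m) :
  x *m y = 0 -> y *m x = 0 ->
  (1%:M + x) *m (1%:M + y) = (1%:M + y) *m (1%:M + x).
Proof.
move=> xy yx; rewrite !mulmxDr !mulmxDl !mulmx1 !mul1mx xy yx !addr0.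
by rewrite addrAC.
Qed.

Lemma near_mx (R : comNzRingType) m (t : R) (x y : 'M[R]_m) :
    x *m x = (- t - 1) *: x -> y *m y = (- t - 1) *: y ->
    x *m y *m x = t *: x -> y *m x *m y = t *: y ->
  (1%:M + x) *m (1%:M + y) *m (1%:M + x) =
  (1%:M + y) *m (1%:M + x) *m (1%:M + y).
Proof.
have half (u v : 'M[R]_m) : u *m u = (- t - 1) *: u -> u *m v *m u = t *: u ->
    (1%:M + u) *m (1%:M + v) *m (1%:M + u) =
    1%:M + (u + v) + (u *m v + v *m u).
  move=> uu uvu; rewrite !mulmxDr !mulmxDl !mulmx1 !mul1mx uu uvu.
  move: (u *m v) (v *m u) (1%:M) => a b I.
  by apply/matrixP=> p q; rewrite !mxE; ring.
move=> xx yy xyx yxy; rewrite !half //.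
by rewrite [x + y]addrC [x *m y + _]addrC.
Qed.

Lemma unit_mx (R : comUnitRingType) m (t : R) (x : 'M[R]_m) :
  t \is a GRing.unit -> x *m x = (- t - 1) *: x -> 1%:M + x \in unitmx.
Proof.
move=> ut xx; have H : (1%:M + x) *m (1%:M + t^-1 *: x) = 1%:M; last first.
  by have [] := mulmx1_unit H.
rewrite mulmxDr mulmx1 -scalemxAr mulmxDl mul1mx xx.
rewrite -addrA -[RHS]addr0; congr (_ + _).
rewrite -{2}[x]scale1r -scalerDl [1 + _]addrC subrK scalerA mulrN.
by rewrite mulVr // scaleN1r subrr.
Qed.

(* The Burau matrices only involve 0, 1, t and -t: over D = int, [burau D n] is
   the representation beta_n, and over D = C it is beta_n followed by the
   inclusion of GL_(n-1)(Z[t, t^-1]) in GL_(n-1)(C[t, t^-1]). *)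
Section Burau.
Variables (D : idomainType) (n : nat).
Local Notation t := (@laurentX D).

Definition burau_mx (r : 'I_n.-1) : 'M[laurent D]_n.-1 :=
  \matrix_(i, j)
    if i != r then (i == j)%:R
    else if j.+1 == r then t
    else if j == r then - t
    else if j == r.+1 :> nat then 1
    else 0.

Let burau_col (r : 'I_n.-1) : 'cV[laurent D]_n.-1 := delta_mx r 0.
Let burau_row (r : 'I_n.-1) : 'rV[laurent D]_n.-1 :=
  \row_j (if j.+1 == r then t
          else if j == r then - t - 1
          else if j == r.+1 :> nat then 1
          else 0).
Let burau_x r := burau_col r *m burau_row r.

Let burau_mxE r : burau_mx r = 1%:M + burau_x r.
Proof.
apply/matrixP=> i j; rewrite !mxE big_ord1 !mxE eqxx andbT.
case: eqVneq => [->|ir] /=; last by rewrite mul0r addr0.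
rewrite mul1r [r == j]eq_sym; case: (eqVneq j r) => [->|jr].
  have -> : (r.+1 == r) = false by lia.
  by rewrite addrC subrK.
by rewrite add0r.
Qed.

Let burau_xx r s :
  burau_x r *m burau_x s = burau_row r 0 s *: (burau_col r *m burau_row s).
Proof.
rewrite /burau_x mulmxA -[X in X *m _]mulmxA.
have -> : burau_row r *m burau_col s = (burau_row r 0 s)%:M.
  by rewrite -colE; apply/matrixP=> i j; rewrite !ord1 !mxE eqxx.
by rewrite mul_mx_scalar scalemxAl.
Qed.

Let burau_xx_same r : burau_x r *m burau_x r = (- t - 1) *: burau_x r.
Proof.
rewrite burau_xx mxE eqxx.
by have -> : (r.+1 == r) = false by lia.
Qed.

Let burau_xx_far (r s : 'I_n.-1) :
  (r.+1 < s)%N || (s.+1 < r)%N -> burau_x r *m burau_x s = 0.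
Proof.
move=> rs; rewrite burau_xx mxE.
have -> : (s.+1 == r) = false by apply/eqP=> e; move: rs; rewrite -e; lia.
have -> : (s == r) = false by apply/eqP=> e; move: rs; rewrite -e; lia.
have -> : (s == r.+1 :> nat) = false by apply/eqP=> e; move: rs; rewrite e; lia.
by rewrite scale0r.
Qed.

Let burau_xxx (r s : 'I_n.-1) : s = r.+1 :> nat \/ r = s.+1 :> nat ->
  burau_x r *m burau_x s *m burau_x r = t *: burau_x r.
Proof.
move=> rs; rewrite burau_xx -scalemxAl mulmxA -[X in X *m _]mulmxA.
have -> : burau_row s *m burau_col r = (burau_row s 0 r)%:M.
  by rewrite -colE; apply/matrixP=> i j; rewrite !ord1 !mxE eqxx.
rewrite mul_mx_scalar -scalemxAl scalerA; congr (_ *: _); rewrite !mxE.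
have -> : (s == r) = false by apply/eqP=> e; move: rs; rewrite e; lia.
have -> : (r == s) = false by apply/eqP=> e; move: rs; rewrite e; lia.
case: rs => e; rewrite e eqxx.
  have -> : (r.+2 == r) = false by lia.
  by rewrite mul1r.
have -> : (s.+2 == s) = false by lia.
by rewrite mulr1.
Qed.

Lemma burau_mx_unit r : burau_mx r \in unitmx.
Proof.
by rewrite burau_mxE; apply: (unit_mx (laurentX_unit D) (burau_xx_same r)).
Qed.

Definition burau_gen (r : 'I_n.-1) : GL (laurent D) n.-1 :=
  Sub (burau_mx r) (burau_mx_unit r).

Lemma burau_relations : braid_relations burau_gen.
Proof.
split=> i j ij; apply: val_inj.
  rewrite -[LHS]/(burau_mx i *m burau_mx j) -[RHS]/(burau_mx j *m burau_mx i).
  by rewrite !burau_mxE; apply: far_mx; apply: burau_xx_far; rewrite ij ?orbT.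
rewrite -[LHS]/(burau_mx i *m burau_mx j *m burau_mx i).
rewrite -[RHS]/(burau_mx j *m burau_mx i *m burau_mx j) !burau_mxE.
apply: (near_mx (burau_xx_same i) (burau_xx_same j)); apply: burau_xxx.
  by left.
by right.
Qed.

Definition burau : braid n -> GL (laurent D) n.-1 := braid_lift burau_gen.

Lemma burauM x y : burau (x * y)%g = (burau x * burau y)%g.
Proof. exact: (braid_liftM burau_relations). Qed.
Lemma burau1 : burau 1%g = 1%g.
Proof. exact: (braid_lift1 burau_relations). Qed.
Lemma burau_sigma r : val (burau (sigma r)) = burau_mx r.
Proof. by rewrite /burau (braid_lift_sigma burau_relations). Qed.

End Burau.

Section Congruence.
Variables (F : fieldType) (m : nat) (alpha : F).
Local Notation L := (laurent F).
Local Notation s := (laurentX - laurentC alpha : L).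
Local Notation cst := (map_mx (@laurentC F)).

(* K^i(alpha), as a set of elements of GL_m(F[t, t^-1]). *)
Definition congr_sub (i : nat) : {pred GL L m} :=
  fun A => (\det (val A) == 1) &&
    `[< exists B : 'M[L]_m, val A = 1%:M + s ^+ i *: B >].

Lemma congr_subP i (A : GL L m) :
  reflect (\det (val A) = 1 /\ exists B : 'M[L]_m, val A = 1%:M + s ^+ i *: B)
          (A \in congr_sub i).
Proof.
by apply: (iffP andP) => [[/eqP dA /asboolP]|[/eqP dA /asboolP]].
Qed.

Lemma congr_sub1 i : 1%g \in congr_sub i.
Proof.
apply/congr_subP; rewrite GLval1 det1; split=> //.
by exists 0; rewrite scaler0 addr0.
Qed.

Lemma congr_subM i A B :
  A \in congr_sub i -> B \in congr_sub i -> (A * B)%g \in congr_sub i.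
Proof.
move=> /congr_subP[dA [A' eA]] /congr_subP[dB [B' eB]]; apply/congr_subP.
rewrite GLvalM det_mulmx dA dB mulr1; split=> //.
exists (A' + B' + s ^+ i *: (A' *m B')).
rewrite eA eB mulmxDl !mulmxDr !mul1mx !mulmx1 -scalemxAl -scalemxAr !scalerDr.
by rewrite !addrA; congr (_ + _); exact: addrAC.
Qed.

Lemma congr_subV i A : A \in congr_sub i -> A^-1%g \in congr_sub i.
Proof.
move=> /congr_subP[dA [A' eA]]; apply/congr_subP.
rewrite GLvalV det_inv dA invr1; split=> //.
exists (- (invmx (val A) *m A')); rewrite scalerN scalemxAr.
apply/eqP; rewrite eq_sym subr_eq -{1}[invmx _]mulmx1 -mulmxDr -eA.
by rewrite mulVmx ?(valP A).
Qed.

Lemma congr_subJ i g A :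
  A \in congr_sub i -> (g * A * g^-1)%g \in congr_sub i.
Proof.
move=> /congr_subP[dA [A' eA]]; apply/congr_subP.
rewrite !GLvalM GLvalV !det_mulmx dA mulr1 det_inv mulrV; last first.
  by rewrite -unitmxE (valP g).
split=> //; exists (val g *m A' *m invmx (val g)).
rewrite eA mulmxDr mulmx1 mulmxDl mulmxV ?(valP g) //.
by rewrite -scalemxAr -scalemxAl.
Qed.

Lemma congr_sub_group i : group_closed (congr_sub i).
Proof.
split=> [|A B KA KB]; first exact: congr_sub1.
by apply: congr_subM => //; apply: congr_subV.
Qed.

Definition Kgroup := {A : GL L m | A \in congr_sub 1}.
HB.instance Definition _ := Choice.on Kgroup.
HB.instance Definition _ : isSub _ _ Kgroup := SubType.on Kgroup.
HB.instance Definition _ :=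
  SubChoice_isSubGroup.Build _ _ Kgroup (congr_sub_group 1).

Definition Krel : rel Kgroup := fun A B => val (A^-1 * B)%g \in congr_sub 2.

Lemma Krel_refl : reflexive Krel.
Proof. by move=> A; rewrite /Krel mulVg congr_sub1. Qed.
Lemma Krel_sym : symmetric Krel.
Proof.
have sub A B : Krel A B -> Krel B A.
  by rewrite /Krel => /congr_subV; rewrite -[(val _)^-1%g]/(val (A^-1 * B)^-1)%g invgM invgK.
by move=> A B; apply/idP/idP; apply: sub.
Qed.
Lemma Krel_trans : transitive Krel.
Proof.
move=> B A C AB BC; have := congr_subM AB BC.
by rewrite -[(val _ * val _)%g]/(val ((A^-1 * B) * (B^-1 * C)))%g mulgA mulgK.
Qed.

Canonical Krel_equiv := EquivRel Krel Krel_refl Krel_sym Krel_trans.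

Definition Kquot := {eq_quot Krel}.
HB.instance Definition _ : EqQuotient _ Krel Kquot := EqQuotient.on Kquot.
HB.instance Definition _ := Choice.on Kquot.

Lemma Kquot_eqP A B : Krel A B <-> \pi_Kquot A = \pi_Kquot B.
Proof. by split=> [AB|/eqmodP //]; apply/eqmodP. Qed.

Lemma KquotW (P : Kquot -> Prop) : (forall A, P (\pi_Kquot A)) -> forall q, P q.
Proof. by move=> Pw q; rewrite -[q]reprK; apply: Pw. Qed.

Lemma Krel_repr A : Krel (qrepr (\pi_Kquot A)) A.
Proof. by apply/Kquot_eqP; rewrite reprK. Qed.

Definition Kquot1 : Kquot := \pi_Kquot 1%g.
Definition KquotM (x y : Kquot) : Kquot := \pi_Kquot (qrepr x * qrepr y)%g.
Definition KquotV (x : Kquot) : Kquot := \pi_Kquot (qrepr x)^-1%g.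

Lemma KrelM A A' B B' : Krel A A' -> Krel B B' -> Krel (A * B)%g (A' * B')%g.
Proof.
rewrite /Krel => AA BB.
have -> : ((A * B)^-1 * (A' * B') =
    (B^-1 * (A^-1 * A') * B^-1^-1) * (B^-1 * B'))%g.
  by rewrite invgM invgK !mulgA mulgK.
by apply: congr_subM => //; apply: congr_subJ.
Qed.

Lemma KrelV A B : Krel A B -> Krel A^-1%g B^-1%g.
Proof.
move=> AB; have := congr_subJ (val B) (congr_subV AB); rewrite /Krel.
rewrite -[X in X \in _]/(val (B * (A^-1 * B)^-1 * B^-1)%g).
by rewrite !invgM !invgK !mulgA mulgV mul1g.
Qed.

Lemma pi_KquotM A B :
  KquotM (\pi_Kquot A) (\pi_Kquot B) = \pi_Kquot (A * B)%g.
Proof. by apply/Kquot_eqP; apply: KrelM; apply: Krel_repr. Qed.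

Lemma KquotMA : associative KquotM.
Proof.
elim/KquotW=> A; elim/KquotW=> B; elim/KquotW=> C.
by rewrite !pi_KquotM mulgA.
Qed.
Lemma Kquot1M : left_id Kquot1 KquotM.
Proof. by elim/KquotW=> A; rewrite pi_KquotM mul1g. Qed.
Lemma KquotM1 : right_id Kquot1 KquotM.
Proof. by elim/KquotW=> A; rewrite pi_KquotM mulg1. Qed.
Lemma KquotVM : left_inverse Kquot1 KquotV KquotM.
Proof. by move=> q; rewrite -[X in KquotM _ X]reprK pi_KquotM mulVg. Qed.
Lemma KquotMV : right_inverse Kquot1 KquotV KquotM.
Proof. by move=> q; rewrite -[X in KquotM X _]reprK pi_KquotM mulgV. Qed.

HB.instance Definition _ :=
  isGroup.Build Kquot KquotMA Kquot1M KquotM1 KquotVM KquotMV.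

Definition Kconj (g : GL L m) (A : Kgroup) : Kgroup :=
  Sub (g * val A * g^-1)%g (congr_subJ g (valP A)).

(* The automorphism f(alpha)(g) of K(alpha) / K^2(alpha). *)
Definition Kquot_conj (g : GL L m) (q : Kquot) : Kquot :=
  \pi_Kquot (Kconj g (qrepr q)).

Lemma KconjM g A B : Kconj g (A * B)%g = (Kconj g A * Kconj g B)%g.
Proof.
apply: val_inj; rewrite -[RHS]/((g * val A * g^-1) * (g * val B * g^-1))%g.
rewrite -[LHS]/(g * (val A * val B) * g^-1)%g !mulgA.
by rewrite -[(g * val A * g^-1 * g)%g]mulgA mulVg mulg1.
Qed.

Lemma KconjV g A : Kconj g A^-1%g = (Kconj g A)^-1%g.
Proof.
apply: (mulgI (Kconj g A)); rewrite -KconjM !mulgV.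
by apply: val_inj; rewrite /= mulg1 mulgV.
Qed.

Lemma Kconj_comp g h A : Kconj (g * h)%g A = Kconj g (Kconj h A).
Proof. by apply: val_inj; rewrite /= invgM !mulgA. Qed.

Lemma Kconj_rel g A B : Krel A B -> Krel (Kconj g A) (Kconj g B).
Proof. by rewrite /Krel -KconjV -KconjM; apply: congr_subJ. Qed.

Lemma pi_Kconj g A : Kquot_conj g (\pi_Kquot A) = \pi_Kquot (Kconj g A).
Proof. exact/Kquot_eqP/Kconj_rel/Krel_repr. Qed.

Lemma Kquot_conjM g x y :
  Kquot_conj g (x * y)%g = (Kquot_conj g x * Kquot_conj g y)%g.
Proof.
elim/KquotW: x => A; elim/KquotW: y => B.
rewrite -[X in Kquot_conj _ X]/(KquotM _ _) -[RHS]/(KquotM _ _).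
by rewrite pi_KquotM !pi_Kconj pi_KquotM KconjM.
Qed.

Lemma Kquot_conj_comp g h x :
  Kquot_conj (g * h)%g x = Kquot_conj g (Kquot_conj h x).
Proof. by elim/KquotW: x => A; rewrite !pi_Kconj Kconj_comp. Qed.

(* Y such that A = I + (t - alpha) Y mod (t - alpha)^2; it exists and is
   unique if alpha != 0, see [tangentP] and [first_order_uniq]. *)
Definition first_order (A : 'M[L]_m) (Y : 'M[F]_m) : Prop :=
  exists B : 'M[L]_m, A = 1%:M + s *: cst Y + s ^+ 2 *: B.

Definition tangent (A : Kgroup) : 'M[F]_m :=
  xget 0 [set Y | first_order (val (val A)) Y]%classic.

Definition Kquot_tangent (q : Kquot) : 'M[F]_m := tangent (qrepr q).

Definition sl : {vspace 'M[F]_m} :=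
  lker (linfun (fun Y : 'M[F]_m => \tr Y : F^o)).

Lemma mem_sl Y : (Y \in sl) = (\tr Y == 0).
Proof. by rewrite memv_ker lfunE. Qed.

(* The inverse of [Kquot_tangent] on sl, see [Kquot_liftK]. *)
Definition Kquot_lift (Y : 'M[F]_m) : Kquot :=
  xget 1%g [set q | Kquot_tangent q = Y]%classic.

(* f(alpha)(g) transported to sl. *)
Definition sl_conj (g : GL L m) (Y : 'M[F]_m) : 'M[F]_m :=
  Kquot_tangent (Kquot_conj g (Kquot_lift Y)).

(* The matrix of f(alpha)(g), acting on columns of coordinates. *)
Definition f_mx (g : GL L m) : 'M[F]_(\dim sl) :=
  \matrix_(i, j) coord (vbasis sl) i (sl_conj g (vbasis sl)`_j).

End Congruence.

Lemma first_order_mulmx (R : comNzRingType) m (s : R) (X Y A B : 'M[R]_m) :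
  (1%:M + s *: X + s ^+ 2 *: A) *m (1%:M + s *: Y + s ^+ 2 *: B) =
  1%:M + s *: (X + Y) + s ^+ 2 *:
    (A + B + X *m Y + s *: (X *m B + A *m Y) + s ^+ 2 *: (A *m B)).
Proof.
rewrite !mulmxDl !mulmxDr !mul1mx !mulmx1 -!scalemxAl -!scalemxAr.
move: (X *m Y) (X *m B) (A *m Y) (A *m B) (1%:M) => XY XB AY AB I.
apply/matrixP=> i j; rewrite !mxE; ring.
Qed.

Lemma first_order_conjmx (R : comNzRingType) m (s : R)
    (g h g0 g1 h0 h1 Y A : 'M[R]_m) :
    g *m h = 1%:M -> g = g0 + s *: g1 -> h = h0 + s *: h1 ->
  g *m (1%:M + s *: Y + s ^+ 2 *: A) *m h =
  1%:M + s *: (g0 *m Y *m h0) +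
    s ^+ 2 *: (g *m A *m h + g1 *m Y *m h + g0 *m Y *m h1).
Proof.
move=> gh eg eh; rewrite !mulmxDr mulmx1 -!scalemxAr !mulmxDl gh -!scalemxAl.
have -> : g *m Y *m h = g0 *m Y *m h0 + s *: (g1 *m Y *m h + g0 *m Y *m h1).
  rewrite {1}eg 2!mulmxDl [X in X + _ = _](_ : _ =
    g0 *m Y *m h0 + s *: (g0 *m Y *m h1)).
    by rewrite -!scalemxAl scalerDr -!addrA; congr (_ + _); rewrite addrC.
  by rewrite eh mulmxDr -scalemxAr.
move: (g *m A *m h) (g1 *m Y *m h) (g0 *m Y *m h1) (g0 *m Y *m h0) (1%:M).
move=> a b c d I; apply/matrixP=> i j; rewrite !mxE; ring.
Qed.

Section CongruenceTheory.
Variables (F : fieldType) (m : nat) (alpha : F).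
Hypothesis alpha0 : alpha != 0.
Local Notation L := (laurent F).
Local Notation s := (laurentX - laurentC alpha : L).
Local Notation cst := (map_mx (@laurentC F)).
Local Notation Kgroup := (Kgroup m alpha).
Local Notation Kquot := (Kquot m alpha).
Local Notation sl := (sl F m).

Lemma s_poly : s = laurent_poly ('X - alpha%:P).
Proof. by rewrite rmorphB. Qed.

Lemma s_neq0 : s != 0.
Proof.
rewrite s_poly -(rmorph0 (@laurent_poly F)).
by rewrite (inj_eq (@laurent_poly_inj F)) polyXsubC_eq0.
Qed.

Lemma residueP (x : L) : exists c y, x = laurentC c + s * y.
Proof.
have [k [p kp]] := laurentP x.
pose c := p.[alpha] / alpha ^+ k.
have /factor_theorem[q qE] : root (p - c *: 'X^k) alpha.
  by rewrite /root !hornerE /c divfK ?expf_neq0 // subrr.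
exists c, (laurentX ^- k * laurent_poly q).
have uX : laurentX ^+ k \is a @GRing.unit L by rewrite unitrX // laurentX_unit.
apply: (mulrI uX).
have -> : laurentX ^+ k * (laurentC c + s * (laurentX ^- k * laurent_poly q)) =
    laurentC c * laurentX ^+ k + laurent_poly q * s.
  by rewrite mulrDr [_ * laurentC c]mulrC [s * _]mulrC mulrA mulVKr.
rewrite kp s_poly -(rmorphM (@laurent_poly F)) -qE -mul_polyC.
rewrite -(rmorphXn (@laurent_poly F)) -[laurentC c]/(laurent_poly c%:P).
by rewrite -(rmorphM (@laurent_poly F)) -rmorphD addrC subrK.
Qed.

Lemma residue_eq0 c y : laurentC c = s * y -> c = 0.
Proof.
have [k [p kp]] := laurentP y => cy.
have : 'X^k * c%:P = ('X - alpha%:P) * p.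
  apply: (@laurent_poly_inj F); rewrite !(rmorphM (@laurent_poly F)).
  rewrite (rmorphXn (@laurent_poly F)) /= -kp -s_poly.
  by rewrite -[laurent_poly c%:P]/(laurentC c) cy mulrCA.
move/(congr1 (horner^~ alpha)); rewrite !hornerE subrr mul0r => /eqP.
by rewrite mulf_eq0 expf_eq0 (negbTE alpha0) andbF /= => /eqP.
Qed.

Lemma residue_mxP (B : 'M[L]_m) :
  exists (B0 : 'M[F]_m) (B1 : 'M[L]_m), B = cst B0 + s *: B1.
Proof.
have /choice[c cP] (ij : 'I_m * 'I_m) :
    exists cy, B ij.1 ij.2 = laurentC cy.1 + s * cy.2.
  by have [c [y e]] := residueP (B ij.1 ij.2); exists (c, y).
exists (\matrix_(i, j) (c (i, j)).1), (\matrix_(i, j) (c (i, j)).2).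
by apply/matrixP=> i j; rewrite !mxE (cP (i, j)).
Qed.

Lemma residue_mx_eq0 (Y : 'M[F]_m) B : cst Y = s *: B -> Y = 0.
Proof.
move=> /matrixP YB; apply/matrixP=> i j; rewrite mxE.
by have := YB i j; rewrite !mxE => /residue_eq0.
Qed.

Lemma first_order_uniq (A : 'M[L]_m) Y Y' :
  first_order alpha A Y -> first_order alpha A Y' -> Y = Y'.
Proof.
move=> [B ->] [B'] e; apply/eqP; rewrite -subr_eq0; apply/eqP.
apply: (@residue_mx_eq0 _ (B' - B)); apply/matrixP=> i j.
move/matrixP/(_ i j): e; rewrite !mxE.
move: (1 *+ _) (B i j) (B' i j) => d b b' e; apply: (mulfI s_neq0).
apply/eqP; rewrite -subr_eq0 rmorphB /=.
rewrite (_ : _ - _ = d + s * laurentC (Y i j) + s ^+ 2 * b -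
                     (d + s * laurentC (Y' i j) + s ^+ 2 * b')); last by ring.
by rewrite e subrr.
Qed.

Lemma tangentP (A : Kgroup) : first_order alpha (val (val A)) (tangent A).
Proof.
apply: (@xgetPex _ 0 [set Y | first_order alpha (val (val A)) Y]%classic).
have /congr_subP[_ [B eB]] := valP A; have [B0 [B1 e]] := residue_mxP B.
by exists B0, B1; rewrite eB e expr1 scalerDr scalerA -expr2 addrA.
Qed.

Lemma tangentE (A : Kgroup) Y : first_order alpha (val (val A)) Y -> tangent A = Y.
Proof. exact/first_order_uniq/tangentP. Qed.

Lemma tangentM (A B : Kgroup) : tangent (A * B)%g = tangent A + tangent B.
Proof.
apply: tangentE; have [A' eA] := tangentP A; have [B' eB] := tangentP B.
rewrite -[val (val _)]/(val (val A) *m val (val B)) eA eB.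
rewrite /first_order map_mxD first_order_mulmx.
by eexists.
Qed.

Lemma tangent1 : tangent (1%g : Kgroup) = 0.
Proof. by apply: (addrI (tangent (1%g : Kgroup))); rewrite -tangentM mulg1 addr0. Qed.

Lemma tangentV (A : Kgroup) : tangent A^-1%g = - tangent A.
Proof. by apply: (addrI (tangent A)); rewrite -tangentM mulgV tangent1 subrr. Qed.

Lemma tangent_conj (g : GL L m) (g0 h0 : 'M[F]_m) (g1 h1 : 'M[L]_m) (A : Kgroup) :
    val g = cst g0 + s *: g1 -> invmx (val g) = cst h0 + s *: h1 ->
  tangent (Kconj g A) = g0 *m tangent A *m h0.
Proof.
move=> eg eh; apply: tangentE; have [A' eA] := tangentP A.
have -> : val (val (Kconj g A)) = val g *m val (val A) *m invmx (val g) by [].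
rewrite eA /first_order !map_mxM.
rewrite (first_order_conjmx _ _ (mulmxV (valP g)) eg eh).
by eexists.
Qed.

Lemma congr_sub2E (A : Kgroup) : (val A \in congr_sub alpha 2) = (tangent A == 0).
Proof.
have /congr_subP[dA _] := valP A; apply/congr_subP/eqP => [[_ [B e]]|t0].
  by apply: tangentE; exists B; rewrite map_mx0 scaler0 addr0.
have [B e] := tangentP A; split=> //; exists B.
by rewrite e t0 map_mx0 scaler0 addr0.
Qed.

Lemma Krel_tangent (A B : Kgroup) : Krel A B = (tangent A == tangent B).
Proof. by rewrite /Krel congr_sub2E tangentM tangentV addrC subr_eq0 eq_sym. Qed.

Lemma Kquot_tangent_pi (A : Kgroup) : Kquot_tangent (\pi_Kquot A) = tangent A.
Proof. by apply/eqP; rewrite -Krel_tangent Krel_repr. Qed.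

Lemma Kquot_tangent_inj : injective (@Kquot_tangent F m alpha).
Proof.
elim/KquotW=> A; elim/KquotW=> B; rewrite !Kquot_tangent_pi => AB.
by apply/Kquot_eqP; rewrite Krel_tangent AB.
Qed.

Lemma Kquot_tangentM (x y : Kquot) :
  Kquot_tangent (x * y)%g = Kquot_tangent x + Kquot_tangent y.
Proof.
elim/KquotW: x => A; elim/KquotW: y => B.
by rewrite -[X in Kquot_tangent X]/(KquotM _ _) pi_KquotM !Kquot_tangent_pi tangentM.
Qed.

Lemma prod_first_order (I : finType) (b : I -> L) :
  exists q, \prod_i (1 + s * b i) = 1 + s * \sum_i b i + s ^+ 2 * q.
Proof.
apply: (big_ind2 (fun x y => exists q, x = 1 + s * y + s ^+ 2 * q)).
- by exists 0; rewrite !mulr0 !addr0.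
- move=> x1 y1 x2 y2 [q1 ->] [q2 ->].
  exists (q1 + q2 + y1 * y2 + s * (y1 * q2 + q1 * y2) + s ^+ 2 * (q1 * q2)).
  ring.
- by move=> i _; exists 0; rewrite mulr0 addr0.
Qed.

Lemma det_first_order (B : 'M[L]_m) :
  exists q, \det (1%:M + s *: B) = 1 + s * \tr B + s ^+ 2 * q.
Proof.
rewrite /determinant (bigD1 (1%g : 'S_m)) //= odd_perm1 expr0 mul1r.
have [q1 e1] := prod_first_order (fun i => B i i).
have [q2 e2] : exists q, \sum_(g : 'S_m | g != 1%g)
    (-1) ^+ g * \prod_i (1%:M + s *: B) i (g i) = s ^+ 2 * q.
  apply: (big_ind (fun x => exists q, x = s ^+ 2 * q)).
  - by exists 0; rewrite mulr0.
  - by move=> x y [q ->] [q' ->]; exists (q + q'); rewrite mulrDr.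
  move=> g g1.
  have [i gi] : exists i, g i != i.
    apply/existsP; rewrite -negb_forall; apply: contra g1 => /forallP fix_g.
    by apply/eqP/permP=> i; rewrite perm1; apply/eqP.
  have ggi : g (g i) != g i by rewrite (inj_eq perm_inj).
  rewrite (bigD1 i) //= (bigD1 (g i)) //= !mxE.
  rewrite (eq_sym i) (eq_sym (g i) (g _)) (negbTE gi) (negbTE ggi) !add0r.
  move: (\prod_(_ | _) _) ((-1) ^+ g) (B i (g i)) => p e b.
  move: (B (g i) _) => b'.
  by exists (e * b * b' * p); ring.
exists (q1 + q2); rewrite e2 mulrDr addrA; congr (_ + _).
rewrite -e1; apply: eq_bigr => i _.
by rewrite !mxE perm1 eqxx.
Qed.

Lemma tangent_sl (A : Kgroup) : tangent A \in sl.
Proof.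
rewrite mem_sl; apply/eqP; have [B e] := tangentP A.
have /congr_subP[dA _] := valP A.
have [q eq] := det_first_order (cst (tangent A) + s *: B).
move: eq; rewrite scalerDr scalerA -expr2 addrA -e dA -addrA -[LHS]addr0.
move/addrI => /esym; rewrite expr2 -mulrA -mulrDr => /eqP.
rewrite mulf_eq0 (negbTE s_neq0) /= mxtraceD mxtraceZ -addrA -mulrDr => /eqP.
have -> : \tr (cst (tangent A)) = laurentC (\tr (tangent A)).
  by rewrite /mxtrace rmorph_sum; apply: eq_bigr => i _; rewrite mxE.
move/eqP; rewrite addr_eq0 -mulrN => /eqP; exact: residue_eq0.
Qed.

Lemma Kquot_tangent_sl (q : Kquot) : Kquot_tangent q \in sl.
Proof. exact: tangent_sl. Qed.

Lemma det_1D_mul (u : 'cV[L]_m) (v : 'rV[L]_m) :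
  v *m u = 0 -> \det (1%:M + u *m v) = 1.
Proof.
move=> vu.
have e : block_mx 1%:M (- v) 0 1%:M *m block_mx 1%:M 0 u 1%:M =
    block_mx 1%:M 0 u 1%:M *m block_mx 1%:M (- v) 0 (1%:M + u *m v).
  rewrite !mulmx_block !mul1mx !mulmx1 !mulmx0 !mul0mx !addr0 !add0r.
  by rewrite mulNmx vu oppr0 addr0 mulmxN addrC addrK.
have /(congr1 determinant) := e.
by rewrite !det_mulmx !det_ublock !det_lblock !det1 !mul1r.
Qed.

Lemma tangent_rank1 (u : 'cV[F]_m) (v : 'rV[F]_m) :
  v *m u = 0 -> exists A : Kgroup, tangent A = u *m v.
Proof.
move=> vu; pose A : 'M[L]_m := 1%:M + s *: cst (u *m v).
have dA : \det A = 1.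
  rewrite /A map_mxM scalemxAr det_1D_mul //.
  by rewrite -scalemxAl -map_mxM vu map_mx0 scaler0.
have uA : A \in unitmx by rewrite unitmxE dA unitr1.
have KA : (Sub A uA : GL L m) \in congr_sub alpha 1.
  by apply/congr_subP; split=> //; exists (cst (u *m v)); rewrite expr1.
exists (Sub (Sub A uA : GL L m) KA); apply: tangentE.
by exists 0; rewrite scaler0 addr0.
Qed.

Lemma tangent_surj Y : Y \in sl -> exists A : Kgroup, tangent A = Y.
Proof.
pose P Y := exists A : Kgroup, tangent A = Y.
have P0 : P 0 by exists 1%g; apply: tangent1.
have PD Y1 Y2 : P Y1 -> P Y2 -> P (Y1 + Y2).
  by move=> [A <-] [B <-]; exists (A * B)%g; apply: tangentM.
have Poff i j c : i != j -> P (c *: delta_mx i j).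
  move=> ij; rewrite -[delta_mx i j](mul_delta_mx (0 : 'I_1)) scalemxAr.
  apply: tangent_rank1; rewrite -scalemxAl mul_delta_mx_0 ?scaler0 //.
  by rewrite eq_sym.
have Pdiag i j c : P (c *: (delta_mx i i - delta_mx j j)).
  have [->|ij] := eqVneq i j; first by rewrite subrr scaler0.
  pose u : 'cV[F]_m := delta_mx i 0 + delta_mx j 0.
  pose v : 'rV[F]_m := c *: (delta_mx 0 i - delta_mx 0 j).
  have uv : u *m v = c *: (delta_mx i i - delta_mx j j) +
      ((- c) *: delta_mx i j + c *: delta_mx j i).
    rewrite -scalemxAr mulmxBr !mulmxDl !mul_delta_mx scaleNr !scalerBr !scalerDr.
    by apply/matrixP=> p q; rewrite !mxE; ring.
  have Puv : P (u *m v).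
    apply: tangent_rank1; rewrite -scalemxAl mulmxBl !mulmxDr !mul_delta_mx.
    rewrite !mul_delta_mx_0 // 1?eq_sym // addr0 add0r subrr scaler0 //.
  rewrite -[X in P X](addrK ((- c) *: delta_mx i j + c *: delta_mx j i)) -uv.
  rewrite opprD -!scaleNr; apply: (PD _ _ Puv).
  by apply: (PD); apply: Poff; rewrite // eq_sym.
rewrite mem_sl => /eqP trY.
case: (posnP m) => [m0|m_gt0].
  suff -> : Y = 0 by [].
  by apply/matrixP=> i; case: i => i im; exfalso; move: im; rewrite m0.
pose o : 'I_m := Ordinal m_gt0.
have -> : Y = \sum_i \sum_j (if i == j then Y i i *: (delta_mx i i - delta_mx o o)
                             else Y i j *: delta_mx i j).
  transitivity (\sum_i (\sum_j Y i j *: delta_mx i j - Y i i *: delta_mx o o)).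
    rewrite sumrB -scaler_suml -[X in X *: _]/(\tr Y) trY scale0r subr0.
    exact: matrix_sum_delta.
  apply: eq_bigr => i _; rewrite (bigD1 i) //= [RHS](bigD1 i) //= eqxx.
  rewrite scalerBr addrAC; congr (_ + _); apply: eq_bigr => j.
  by rewrite eq_sym => /negbTE ->.
apply: (big_ind P) => // i _; apply: (big_ind P) => // j _.
by case: eqVneq => [_|ij]; [apply: Pdiag | apply: Poff].
Qed.

Lemma Kquot_liftK (Y : 'M[F]_m) :
  Y \in sl -> Kquot_tangent (Kquot_lift alpha Y) = Y.
Proof.
move=> /tangent_surj[A eA].
apply: (@xgetPex _ 1%g [set q : Kquot | Kquot_tangent q = Y]%classic).
by exists (\pi_Kquot A); rewrite /= Kquot_tangent_pi.
Qed.

Lemma Kquot_tangentK (q : Kquot) : Kquot_lift alpha (Kquot_tangent q) = q.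
Proof. exact/Kquot_tangent_inj/Kquot_liftK/Kquot_tangent_sl. Qed.

Lemma sl_conj_tangent (g : GL L m) (q : Kquot) :
  sl_conj alpha g (Kquot_tangent q) = Kquot_tangent (Kquot_conj g q).
Proof. by rewrite /sl_conj Kquot_tangentK. Qed.

Lemma sl_conjE (g : GL L m) (g0 h0 : 'M[F]_m) (g1 h1 : 'M[L]_m) (Y : 'M[F]_m) :
    val g = cst g0 + s *: g1 -> invmx (val g) = cst h0 + s *: h1 -> Y \in sl ->
  sl_conj alpha g Y = g0 *m Y *m h0.
Proof.
move=> eg eh /Kquot_liftK {2}<-; rewrite /sl_conj.
elim/KquotW: (Kquot_lift alpha Y) => A.
by rewrite pi_Kconj !Kquot_tangent_pi (tangent_conj A eg eh).
Qed.

Lemma f_mxE (g : GL L m) (Y : 'M[F]_m) : Y \in sl ->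
  \col_i coord (vbasis sl) i (sl_conj alpha g Y) =
  f_mx alpha g *m \col_i coord (vbasis sl) i Y.
Proof.
move=> Ysl; have [g0 [g1 eg]] := residue_mxP (val g).
have [h0 [h1 eh]] := residue_mxP (invmx (val g)).
apply/colP=> i; rewrite !mxE (sl_conjE eg eh Ysl).
rewrite [in LHS](coord_vbasis Ysl) mulmx_sumr mulmx_suml linear_sum /=.
apply: eq_bigr => j _; rewrite -scalemxAr -scalemxAl linearZ /= !mxE mulrC.
by rewrite (sl_conjE eg eh) // vbasis_mem ?mem_nth ?size_tuple.
Qed.

Lemma sl_conj_sl (g : GL L m) Y : sl_conj alpha g Y \in sl.
Proof. exact: Kquot_tangent_sl. Qed.

Lemma sl_coord_inj (Y Z : 'M[F]_m) : Y \in sl -> Z \in sl ->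
  \col_i coord (vbasis sl) i Y = \col_i coord (vbasis sl) i Z -> Y = Z.
Proof.
move=> Ysl Zsl /colP e; rewrite (coord_vbasis Ysl) (coord_vbasis Zsl).
by apply: eq_bigr => i _; have := e i; rewrite !mxE => ->.
Qed.

Lemma sl_conj_comp (g h : GL L m) Y : Y \in sl ->
  sl_conj alpha (g * h)%g Y = sl_conj alpha g (sl_conj alpha h Y).
Proof.
move=> /Kquot_liftK <-; rewrite !sl_conj_tangent.
by rewrite Kquot_conj_comp.
Qed.

Lemma f_mxM (g h : GL L m) : f_mx alpha (g * h)%g = f_mx alpha g *m f_mx alpha h.
Proof.
apply/matrixP=> i j; pose e := (vbasis sl)`_j.
have esl : e \in sl by rewrite vbasis_mem ?mem_nth ?size_tuple.
have := f_mxE g (sl_conj_sl h e); rewrite -sl_conj_comp // => /colP/(_ i).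
rewrite !mxE => ->; apply: eq_bigr => k _; by rewrite !mxE.
Qed.

Lemma f_mx1 : f_mx alpha (1%g : GL L m) = 1%:M.
Proof.
apply/matrixP=> i j; rewrite !mxE (@sl_conjE _ 1%:M 1%:M 0 0).
- by rewrite mul1mx mulmx1 coord_free 1?eq_sym // (basis_free (vbasisP _)).
- by rewrite map_mx1 scaler0 addr0.
- by rewrite GLval1 invmx1 map_mx1 scaler0 addr0.
- by rewrite vbasis_mem ?mem_nth ?size_tuple.
Qed.

End CongruenceTheory.

Lemma dim_sl (F : fieldType) (n : nat) : \dim (sl F n.+1) = (n.+2 * n)%N.
Proof.
have := limg_ker_dim (linfun (fun Y : 'M[F]_n.+1 => \tr Y : F^o)) fullv.
rewrite capfv -/(sl F n.+1) dimvf /dim /=.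
have -> : limg (linfun (fun Y : 'M[F]_n.+1 => \tr Y : F^o)) = fullv.
  apply/eqP; rewrite eqEsubv subvf /=; apply/subvP=> c _.
  have -> : c = linfun (fun Y : 'M[F]_n.+1 => \tr Y : F^o) (c *: delta_mx 0 0).
    rewrite lfunE /= mxtraceZ /mxtrace (bigD1 0) //= big1 => [|i i0].
      by rewrite !mxE eqxx addr0 mulr1.
    by rewrite mxE (negbTE i0).
  exact: memv_img (memvf _).
rewrite dimvf /dim /= => e.
by apply: (@addIn 1); rewrite e; ring.
Qed.

Section Rho.
Variables (F : fieldType) (n : nat) (alpha : F).

Definition rho (b : braid n) : 'M[F]_(\dim (sl F n.-1)) :=
  f_mx alpha (burau F b).

Lemma rhoM (x y : braid n) : alpha != 0 -> rho (x * y)%g = rho x *m rho y.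
Proof. by move=> a0; rewrite /rho burauM f_mxM. Qed.

Lemma rho1 : alpha != 0 -> rho 1%g = 1%:M.
Proof. by move=> a0; rewrite /rho burau1 f_mx1. Qed.

End Rho.

Section SymRepr.
Variables (F : fieldType) (n : nat).
Local Notation G := [set: 'S_n]%G.

Lemma natural_mx_repr : mx_repr G (fun g : 'S_n => perm_mx g : 'M[F]_n).
Proof. by split=> [|g h _ _]; rewrite ?perm_mx1 ?perm_mxM. Qed.
Definition natural_repr := MxRepresentation natural_mx_repr.

(* The row vectors whose coordinates sum to 0. *)
Definition sum_zero : 'M[F]_n := kermx (const_mx 1 : 'cV_n).

Lemma sum_zero_module : mxmodule natural_repr sum_zero.
Proof.
apply/mxmoduleP=> g _; apply/sub_kermxP; rewrite -mulmxA /=.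
have -> : perm_mx g *m const_mx 1 = const_mx 1 :> 'cV[F]_n.
  by rewrite -row_permE; apply/matrixP=> i j; rewrite !mxE.
exact: mulmx_ker.
Qed.

Definition standard_repr := submod_repr sum_zero_module.

End SymRepr.

Section ExteriorSquare.
Variables (F : fieldType) (gT : finGroupType) (G : {group gT}) (d : nat).
Variable rG : mx_representation F G d.

(* The tensor square of 'rV_d is 'M_d with v (x) w := v^T *m w, on which g
   acts by v (x) w |-> (v *m rG g) (x) (w *m rG g). *)
Definition tensor2_mx (g : gT) : 'M[F]_(d * d) :=
  lin_mx (fun M : 'M[F]_d => (rG g)^T *m M *m rG g).

Lemma tensor2_mxE g M :
  mxvec M *m tensor2_mx g = mxvec ((rG g)^T *m M *m rG g).
Proof.
pose f : {linear 'M[F]_d -> 'M[F]_d} := mulmxr (rG g) \o mulmx (rG g)^T.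
exact: (mul_vec_lin f).
Qed.

Lemma tensor2_mx_repr : mx_repr G tensor2_mx.
Proof.
split=> [|g h Gg Gh]; apply/row_matrixP=> k; rewrite !rowE.
  rewrite mulmx1 -[delta_mx _ _]vec_mxK tensor2_mxE repr_mx1.
  by rewrite trmx1 mul1mx mulmx1.
rewrite -[delta_mx _ _]vec_mxK mulmxA !tensor2_mxE repr_mxM //.
by rewrite trmx_mul !mulmxA.
Qed.
Definition tensor2_repr := MxRepresentation tensor2_mx_repr.

(* The antisymmetric tensors: those negated by v (x) w |-> w (x) v. *)
Definition antisym : 'M[F]_(d * d) :=
  kermx (lin_mx (fun M : 'M[F]_d => M + M^T)).

Lemma mem_antisym M : (mxvec M <= antisym)%MS = (M^T == - M).
Proof.
pose f : {linear 'M[F]_d -> 'M[F]_d} := (idfun \+ @trmx F d d)%R.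
rewrite (sameP sub_kermxP eqP) (mul_vec_lin f) /= -[0](linear0 mxvec).
by rewrite (inj_eq (can_inj mxvecK)) addrC addr_eq0.
Qed.

Lemma antisym_module : mxmodule tensor2_repr antisym.
Proof.
apply/mxmoduleP=> g _; apply/row_subP=> k; rewrite row_mul.
have : (row k antisym <= antisym)%MS by apply: row_sub.
rewrite -[row k _]vec_mxK tensor2_mxE !mem_antisym => /eqP e.
by rewrite !trmx_mul trmxK e mulNmx mulmxN mulmxA.
Qed.

(* The exterior square, as the space of antisymmetric tensors (this requires
   that F be of characteristic different from 2). *)
Definition exterior2_repr := submod_repr antisym_module.

End ExteriorSquare.

Section Specht.
Variables (F : fieldType) (n : nat) (lam : seq nat).
Local Notation G := [set: 'S_n]%G.

(* The entries 0, ..., n - 1 are written in this order in the Young diagram of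
   the partition lam of n, row after row; cell i is in row [tab_row i] and in
   column [tab_col i].  A tabloid is represented by the function mapping each
   entry to the row that contains it. *)
Definition tab_row (i : 'I_n) : 'I_(size lam).+1 := inord (reshape_index lam i).
Definition tab_col (i : 'I_n) : nat := reshape_offset lam i.

Definition tabloid := {ffun 'I_n -> 'I_(size lam).+1}.

Definition tabloid_act (f : tabloid) (g : 'S_n) : tabloid :=
  [ffun i => f (g^-1%g i)].

Definition tabloid_mx (g : 'S_n) : 'M[F]_#|tabloid| :=
  \matrix_(i, j) (tabloid_act (enum_val i) g == enum_val j)%:R.

Lemma tabloid_act1 f : tabloid_act f 1%g = f.
Proof. by apply/ffunP=> i; rewrite ffunE invg1 perm1. Qed.
Lemma tabloid_actM f g h :
  tabloid_act f (g * h)%g = tabloid_act (tabloid_act f g) h.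
Proof. by apply/ffunP=> i; rewrite !ffunE invMg permM. Qed.

Definition tabloid_vec (f : tabloid) : 'rV[F]_#|tabloid| :=
  delta_mx 0 (enum_rank f).

Lemma tabloid_mxE f g :
  tabloid_vec f *m tabloid_mx g = tabloid_vec (tabloid_act f g).
Proof.
rewrite -rowE; apply/rowP=> j; rewrite !mxE enum_rankK eqxx /=.
by rewrite -(inj_eq enum_rank_inj) enum_valK eq_sym.
Qed.

Lemma tabloid_mx_repr : mx_repr G tabloid_mx.
Proof.
have E k : delta_mx 0 k = tabloid_vec (enum_val k) by rewrite /tabloid_vec enum_valK.
split=> [|g h _ _]; apply/row_matrixP=> k; rewrite !rowE !E.
  by rewrite mulmx1 tabloid_mxE tabloid_act1.
by rewrite mulmxA !tabloid_mxE tabloid_actM.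
Qed.
Definition tabloid_repr := MxRepresentation tabloid_mx_repr.

Definition column_group : {set 'S_n} :=
  [set g : 'S_n | [forall i, tab_col (g i) == tab_col i]].

Definition polytabloid : 'rV[F]_#|tabloid| :=
  \sum_(g in column_group)
     (-1) ^+ g *: tabloid_vec (tabloid_act [ffun i => tab_row i] g).

(* The Specht module S^lam, generated by the polytabloid; if F has
   characteristic 0 and lam is a partition of n, it is the irreducible
   representation of 'S_n corresponding to lam. *)
Definition specht_repr :=
  submod_repr (cyclic_mx_module tabloid_repr polytabloid).

End Specht.

(* Main.v *)
Require Import Defs.
From HB Require Import structures.
From mathcomp Require Import all_boot all_order all_algebra all_fingroup.
From mathcomp Require Import mxrepresentation character.
From mathcomp Require Import reals complex.
From mathcomp Require Import ring zify.

(** At t = 1 the Burau matrix of sigma_r is the simple reflection exchanging x_r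
    and x_(r+1), written in the basis of the simple roots x_i - x_(i+1) of the
    hyperplane V of vectors with coordinate sum 0.  Hence the value at t = 1 of
    the Burau matrix of a braid is the action on V of its permutation g
    ([burau_at1]), and rho(1) is conjugation by g on sl(V), which factors
    through the symmetric group ([conj_mx_rho]).

    The space of row vectors on which the matrices of this representation act
    is the dual of sl(V).  Each of its elements is Y |-> tr (Z Y) for some Z in
    End(V), unique up to adding a scalar, and g acts by Z |-> g^-1 Z g.  End(V)
    is the space of the n x n matrices whose rows and columns all sum to 0, on
    which g permutes rows and columns simultaneously, and the identity of V
    becomes the centering matrix I - J/n, J being the all-ones matrix.
    So an equivariant linear map into this space which is bijective modulo the
    centering matrix is a similarity with rho(1) ([conj_repr_rsim]).

    It remains to split this space.  The antisymmetric matrices form the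
    exterior square of V.  A symmetric matrix with zero sums is determined by
    its off-diagonal entries, a function on the edges of the complete graph on
    n vertices.  The diagonals are realised by the centering matrix, of constant
    diagonal, and by an explicit copy of V ([vertex_form]), so that what is left
    are the symmetric matrices with zero diagonal and zero row sums
    ([zero_sum_decomposition], [zero_sum_independence]).  For n = 3 there are
    none but 0.

    For n >= 4 they form the Specht module of shape (n-2, 2): a tabloid of
    this shape is an edge, and a polytabloid is an alternating 4-cycle
    ab - cb - ad + cd ([cross_mx]).  The map from tabloids to edges is injective
    on the Specht module ([specht_form_eq0]).  It reaches every such Z because
    averaging the 4-cycles against the entries of Z returns a nonzero multiple
    of Z ([edge_form_average], [specht_form_surj]). *)

Set Implicit Arguments.
Unset Strict Implicit.
Unset Printing Implicit Defensive.

Import GRing.Theory Num.Theory.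
Local Open Scope ring_scope.

(** * Simple roots and fundamental weights of the symmetric group *)

Section RootsAndWeights.
Variables (F : numFieldType) (m : nat).
Local Notation n := m.+1.

Definition root_mx : 'M[F]_(n, m) :=
  \matrix_(i, j) ((i == j :> nat)%:R - (i == j.+1 :> nat)%:R).

(** The j-th row maps a vector to its coefficient on the j-th simple root, after
    projection to the sum-zero hyperplane: this coefficient is the sum of the
    coordinates 0, ..., j of the projected vector. *)
Definition weight_mx : 'M[F]_(m, n) :=
  \matrix_(j, i) ((i <= j)%N%:R - j.+1%:R / n%:R).

Definition centering_mx : 'M[F]_n := 1%:M - const_mx n%:R^-1.

Lemma natn_neq0 : n%:R != 0 :> F.
Proof. by rewrite pnatr_eq0. Qed.

Lemma sum_indicator (p k : nat) (q : nat -> F) :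
  \sum_(j < p) (k == j :> nat)%:R * q j = (k < p)%N%:R * q k.
Proof.
have [kp|kp] := ltnP k p.
  rewrite (bigD1 (Ordinal kp)) //= eqxx big1 ?addr0 // => j.
  by rewrite -val_eqE /= eq_sym => /negbTE ->; rewrite mul0r.
rewrite mul0r big1 // => j _.
have -> : (k == j :> nat) = false by rewrite gtn_eqF // (leq_trans _ kp).
by rewrite mul0r.
Qed.

Lemma weight_root : weight_mx *m root_mx = 1%:M.
Proof.
apply/matrixP=> r j; rewrite !mxE.
pose q i : F := (i <= r)%N%:R - r.+1%:R / n%:R.
transitivity (\sum_(i < n) ((j == i :> nat)%:R * q i - (j.+1 == i :> nat)%:R * q i)).
  by apply: eq_bigr => i _; rewrite !mxE /q ![_ == i :> nat]eq_sym mulrBr ![q i * _]mulrC.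
rewrite sumrB !sum_indicator ltnS ltnW // ltnS ltn_ord !mul1r /q.
have -> : (r == j) = (j <= r)%N && ~~ (j < r)%N by rewrite -leqNgt eq_sym -val_eqE eqn_leq.
case: (ltngtP j r) => _ /=; ring.
Qed.

Lemma root_weight : root_mx *m weight_mx = centering_mx.
Proof.
apply/matrixP=> i k; rewrite !mxE.
pose q j : F := (k <= j)%N%:R - j.+1%:R / n%:R.
have nn := natn_neq0.
transitivity ((i < m)%N%:R * q i - (0 < i)%N%:R * q i.-1).
  rewrite -sum_indicator.
  have -> : (0 < i)%N%:R * q i.-1 = \sum_(j < m) (i == j.+1 :> nat)%:R * q j.
    case: i => [[|i] im] /=; first by rewrite mul0r big1 // => j _; rewrite mul0r.
    have := sum_indicator m i q; rewrite -ltnS im mul1r => <-.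
    by apply: eq_bigr => j _; rewrite eqSS.
  by rewrite -sumrB; apply: eq_bigr => j _; rewrite !mxE mulrBl.
have kn : (k <= m)%N by rewrite -ltnS.
have -> : (i < m)%N%:R * q i = q i.
  have := ltn_ord i; rewrite ltnS leq_eqVlt => /orP[/eqP e|->]; last by rewrite mul1r.
  by rewrite e ltnn mul0r /q kn divff // subrr.
have -> : (0 < i)%N%:R * q i.-1 = (k < i)%N%:R - i%:R / n%:R.
  case: (i : nat) => [|j] /=; first by rewrite !mul0r subrr.
  by rewrite mul1r /q ltnS.
rewrite /q (_ : (i == k) = (k <= i)%N && ~~ (k < i)%N); last first.
  by rewrite -leqNgt eq_sym -val_eqE eqn_leq.
rewrite -[in i.+1%:R]addn1 natrD mulrDl.
case: (ltngtP k i) => _ /=; rewrite mul1r; move: n%:R^-1 => u; ring.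
Qed.

Lemma ones_root : (const_mx 1 : 'rV_n) *m root_mx = 0.
Proof.
apply/matrixP=> i j; rewrite !mxE.
transitivity (\sum_(i < n) ((j == i :> nat)%:R * 1 - (j.+1 == i :> nat)%:R * 1) : F).
  by apply: eq_bigr => k _; rewrite !mxE ![_ == k :> nat]eq_sym !mulr1 mul1r.
rewrite sumrB (sum_indicator _ _ (fun=> 1)) (sum_indicator _ _ (fun=> 1)).
by rewrite ltnS ltnW // ltnS ltn_ord subrr.
Qed.

Lemma center_ones : centering_mx *m (const_mx 1 : 'cV_n) = 0.
Proof.
apply/matrixP=> i j; rewrite mulmxBl mul1mx !mxE.
under eq_bigr do rewrite !mxE mulr1.
by rewrite sumr_const card_ord -[_ *+ n]mulr_natl divff ?natn_neq0 ?subrr.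
Qed.

Lemma weight_center : weight_mx *m centering_mx = weight_mx.
Proof. by rewrite -root_weight mulmxA weight_root mul1mx. Qed.

Lemma center_root : centering_mx *m root_mx = root_mx.
Proof. by rewrite -root_weight -mulmxA weight_root mulmx1. Qed.

Lemma weight_ones : weight_mx *m (const_mx 1 : 'cV_n) = 0.
Proof. by rewrite -weight_center -mulmxA center_ones mulmx0. Qed.

Lemma perm_mx_center (g : 'S_n) :
  perm_mx g *m centering_mx = centering_mx *m perm_mx g.
Proof.
rewrite mulmxBl mulmxBr mul1mx mulmx1; congr (_ - _).
by rewrite -row_permE -[g in RHS]invgK -col_permE; apply/matrixP=> i j; rewrite !mxE.
Qed.

(** The action of g on the sum-zero hyperplane, in the basis of simple roots. *)
Definition refl_mx (g : 'S_n) : 'M[F]_m := weight_mx *m perm_mx g *m root_mx.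

Lemma root_refl g : root_mx *m refl_mx g = perm_mx g *m root_mx.
Proof.
by rewrite /refl_mx !mulmxA root_weight -perm_mx_center -mulmxA center_root.
Qed.

Lemma refl_weight g : refl_mx g *m weight_mx = weight_mx *m perm_mx g.
Proof.
by rewrite /refl_mx -mulmxA root_weight -mulmxA perm_mx_center mulmxA weight_center.
Qed.

Lemma refl_mx1 : refl_mx 1%g = 1%:M.
Proof. by rewrite /refl_mx perm_mx1 mulmx1 weight_root. Qed.

Lemma refl_mxM g h : refl_mx (g * h)%g = refl_mx g *m refl_mx h.
Proof.
by rewrite {3}/refl_mx !mulmxA refl_weight /refl_mx perm_mxM !mulmxA.
Qed.

End RootsAndWeights.

(** * The Burau representation at t = 1 *)

Section BurauAtOne.
Variables (F : numFieldType) (m : nat).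
Local Notation n := m.+1.
Local Notation L := (laurent F).
Local Notation s := (laurentX - laurentC 1 : L).
Local Notation cst := (map_mx (@laurentC F)).

Definition residue_at1 (A : 'M[L]_m) (X : 'M[F]_m) : Prop :=
  exists B, A = cst X + s *: B.

Lemma residue_at1M A B X Y :
  residue_at1 A X -> residue_at1 B Y -> residue_at1 (A *m B) (X *m Y).
Proof.
move=> [A1 ->] [B1 ->]; exists (cst X *m B1 + A1 *m (cst Y + s *: B1)).
by rewrite mulmxDl mulmxDr -scalemxAl -scalemxAr scalerDr addrA map_mxM.
Qed.

(** Reduction modulo t - 1 is a ring morphism, so the value at 1 of the inverse
    is the inverse of the value at 1. *)
Lemma residue_at1V (g : GL L m) (X Y : 'M[F]_m) :
  residue_at1 (val g) X -> X *m Y = 1%:M -> residue_at1 (val g^-1%g) Y.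
Proof.
move=> gX XY; have [Z [B eZ]] := residue_mxP (oner_neq0 F) (val g^-1%g).
have gZ : residue_at1 (val g^-1%g) Z by exists B.
suff XZ : Z *m X = 1%:M by rewrite -[Y]mul1mx -XZ -mulmxA XY mulmx1.
have [C] := residue_at1M gZ gX; rewrite -GLvalM mulVg GLval1 => e.
apply/eqP; rewrite -subr_eq0; apply/eqP.
apply: (residue_mx_eq0 (oner_neq0 F) (B := - C)).
by rewrite map_mxB map_mx1 e opprD addrA subrr add0r scalerN.
Qed.

(** Both matrices agree after multiplication by the matrix of simple roots,
    which has a left inverse: permuting the coordinates by the transposition
    adds to the j-th root a multiple of the r-th one, and the coefficient is the
    (r, j) entry, at t = 1, of the Burau matrix minus the identity. *)
Lemma burau_mx_at1 (r : 'I_m) :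
  residue_at1 (@burau_mx F n r) (refl_mx F (@adj_tperm n r)).
Proof.
pose X : 'M[F]_m := \matrix_(i, j)
    if i != r then (i == j)%:R
    else if j.+1 == r then 1
    else if j == r then - 1
    else if j == r.+1 :> nat then 1
    else 0.
have -> : refl_mx F (@adj_tperm n r) = X.
  rewrite /refl_mx -mulmxA.
  suff -> : perm_mx (@adj_tperm n r) *m root_mx F m = root_mx F m *m X.
    by rewrite mulmxA weight_root mul1mx.
  (* y is the r-th row of X - 1, the only nonzero one. *)
  pose y : 'rV[F]_m := \row_j ((j.+1 == r :> nat)%:R - (j == r)%:R *+ 2 + (j == r.+1 :> nat)%:R).
  have -> : X = 1%:M + delta_mx r 0 *m y.
    apply/matrixP=> i j; rewrite !mxE big_ord1 !mxE eqxx andbT.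
    case: eqVneq => [->|ir] /=; last by rewrite mul0r addr0.
    rewrite mul1r [r == j]eq_sym -![j == r]val_eqE /=.
    have : [&& ~~ ((j.+1 == r :> nat) && (j == r :> nat)),
        ~~ ((j.+1 == r :> nat) && (j == r.+1 :> nat))
      & ~~ ((j == r :> nat) && (j == r.+1 :> nat))] by lia.
    by case: (_ == _) (_ == _) (_ == _) => [] [] [] //= _; ring.
  rewrite mulmxDr mulmx1 mulmxA -colE; apply/matrixP=> i j.
  rewrite -row_permE !mxE big_ord1 !mxE.
  case: tpermP => [->|->|/eqP + /eqP +]; rewrite -?val_eqE /= ?eqSS.
  - rewrite ![_ == j :> nat]eq_sym [_ == j.+1 :> nat]eq_sym eqxx.
    by rewrite [r == r.+1 :> nat]ltn_eqF // subr0 mul1r; ring.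
  - rewrite ![_ == j :> nat]eq_sym [_ == j.+1 :> nat]eq_sym eqxx.
    by rewrite [r.+1 == r :> nat]gtn_eqF // sub0r mulN1r; ring.
  - by move=> /negbTE-> /negbTE->; ring.
exists (\matrix_(i, j)
    if i != r then 0 else if j.+1 == r then 1 else if j == r then - 1 else 0).
apply/matrixP=> i j; rewrite !mxE.
case: ifP => _; first by rewrite rmorph_nat mulr0 addr0.
case: ifP => _; first by rewrite mulr1 rmorph1 addrC subrK.
case: ifP => _; first by rewrite rmorphN rmorph1; ring.
by case: ifP => _; rewrite ?rmorph1 ?rmorph0 mulr0 addr0.
Qed.

Lemma burau_at1 (b : braid n) :
  residue_at1 (val (burau F b)) (refl_mx F (braid_perm b)).
Proof.
have gen r : residue_at1 (val (burau F (sigma r : braid n)))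
    (refl_mx F (@adj_tperm n r)).
  by rewrite burau_sigma; apply: burau_mx_at1.
elim/braid_sigma_ind: b => [|r b IH|r b IH].
- rewrite burau1 braid_perm1 refl_mx1; exists 0.
  by rewrite GLval1 map_mx1 scaler0 addr0.
- rewrite burauM braid_permM refl_mxM braid_perm_sigma.
  exact: residue_at1M (gen r) IH.
- rewrite burauM braid_permM refl_mxM; apply: residue_at1M IH.
  have -> : burau F (sigma r : braid n)^-1%g = (burau F (sigma r : braid n))^-1%g.
    by apply: (mulIg (burau F (sigma r : braid n))); rewrite mulVg -burauM mulVg burau1.
  apply: residue_at1V (gen r) _.
  by rewrite -refl_mxM -braid_perm_sigma -braid_permM mulgV braid_perm1 refl_mx1.
Qed.

Definition conj_mx (g : 'S_n) : 'M[F]_(\dim (sl F m)) :=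
  \matrix_(i, j) coord (vbasis (sl F m)) i
    (refl_mx F g *m (vbasis (sl F m))`_j *m refl_mx F g^-1%g).

Lemma conj_mx_rho (b : braid n) : conj_mx (braid_perm b) = rho (1 : F) b.
Proof.
apply/matrixP=> i j; rewrite mxE /rho /f_mx [RHS]mxE; congr (coord _ _ _).
have [g1 eg] := burau_at1 b.
have rV : refl_mx F (braid_perm b) *m refl_mx F (braid_perm b)^-1%g = 1%:M.
  by rewrite -refl_mxM mulgV refl_mx1.
have [h1 eh] := residue_at1V (burau_at1 b) rV.
rewrite GLvalV in eh; apply/esym/(sl_conjE (oner_neq0 F) eg eh).
by rewrite vbasis_mem ?mem_nth ?size_tuple.
Qed.

(** Multiplicativity is inherited from [rho], since every permutation comes from
    a braid. *)
Lemma conj_mx_repr : mx_repr [set: 'S_n]%G conj_mx.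
Proof.
split=> [|g h _ _]; first by rewrite -(braid_perm1 n) conj_mx_rho rho1 ?oner_neq0.
have [[x <-] [y <-]] := (braid_perm_surj g, braid_perm_surj h).
by rewrite -braid_permM !conj_mx_rho rhoM ?oner_neq0.
Qed.
Definition conj_repr := MxRepresentation conj_mx_repr.

End BurauAtOne.

(** * The trace form and matrices with zero row and column sums *)

Section TraceForm.
Variables (F : numFieldType) (m : nat).
Local Notation n := m.+1.
Local Notation sl := (sl F m).
Local Notation P g := (perm_mx g : 'M[F]_n).
Local Notation root := (root_mx F m).
Local Notation weight := (weight_mx F m).
Local Notation centering := (centering_mx F m).

Definition zero_sum (Z : 'M[F]_n) : Prop :=
  Z *m (const_mx 1 : 'cV_n) = 0 /\ (const_mx 1 : 'rV_n) *m Z = 0.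

Lemma zero_sum_center Z : zero_sum Z -> centering *m Z *m centering = Z.
Proof.
have e : const_mx n%:R^-1 = n%:R^-1 *: ((const_mx 1 : 'cV[F]_n) *m (const_mx 1 : 'rV_n)).
  by apply/matrixP=> i j; rewrite !mxE big_ord1 !mxE !mulr1.
move=> [Zr Zc]; rewrite /centering_mx e mulmxBl mul1mx -scalemxAl -mulmxA Zc.
rewrite mulmx0 scaler0 subr0 mulmxBr mulmx1 -scalemxAr mulmxA Zr.
by rewrite mul0mx scaler0 subr0.
Qed.

(** The coordinates of the functional Y |-> tr (Z Y) on sl(V), where Z acts on V
    through its matrix in the basis of simple roots. *)
Definition trace_form (Z : 'M[F]_n) : 'rV[F]_(\dim sl) :=
  \row_i \tr (weight *m Z *m root *m (vbasis sl)`_i).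

Lemma trace_form_is_linear : linear trace_form.
Proof.
move=> a Z1 Z2; apply/rowP=> i.
by rewrite !mxE mulmxDr !mulmxDl -scalemxAr -!scalemxAl mxtraceD mxtraceZ.
Qed.
HB.instance Definition _ :=
  GRing.isLinear.Build F 'M[F]_n 'rV[F]_(\dim sl) _ trace_form trace_form_is_linear.

Lemma trace_formE Z Y : Y \in sl ->
  \tr (weight *m Z *m root *m Y) =
  \sum_i trace_form Z 0 i * coord (vbasis sl) i Y.
Proof.
move=> Ysl; rewrite {1}(coord_vbasis Ysl) mulmx_sumr raddf_sum /=.
by apply: eq_bigr => i _; rewrite -scalemxAr mxtraceZ mxE mulrC.
Qed.

Lemma vbasis_sl i : (i < \dim sl)%N -> (vbasis sl)`_i \in sl.
Proof. by move=> id; rewrite vbasis_mem ?mem_nth ?size_tuple. Qed.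

(** By cyclicity of the trace, Y |-> tr (Z (g Y g^-1)) is Y |-> tr ((g^-1 Z g) Y).
    This is why the action by row vectors, dual to conjugation, is again a
    conjugation. *)
Lemma trace_form_conj Z g :
  trace_form Z *m conj_repr F m g = trace_form ((P g)^T *m Z *m P g).
Proof.
apply/rowP=> j; rewrite !mxE.
under eq_bigr => i _ do rewrite [conj_mx _ _ _ _]mxE.
rewrite -trace_formE; last first.
  rewrite mem_sl mxtrace_mulC mulmxA -refl_mxM mulVg refl_mx1 mul1mx -mem_sl.
  exact: vbasis_sl.
move: (root_refl F g) (refl_weight F g^-1%g).
move: (refl_mx F g) (refl_mx F g^-1%g) => a b rootE weightE.
rewrite tr_perm_mx !mulmxA mxtrace_mulC !mulmxA weightE.
by rewrite -[_ *m root *m a]mulmxA rootE !mulmxA.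
Qed.

Lemma mxtrace_mul_delta (N : 'M[F]_m) i j : \tr (N *m delta_mx i j) = N j i.
Proof.
rewrite -(mul_delta_mx (0 : 'I_1)) mulmxA mxtrace_mulC mulmxA -rowE -colE.
by rewrite trace_mx11 !mxE.
Qed.

(** The matrix units E_ij with i <> j and the E_ii - E_jj are in sl; testing
    against them kills the off-diagonal entries and makes the diagonal
    constant. *)
Lemma scalar_of_trace_orthogonal (N : 'M[F]_m) :
  (forall Y, Y \in sl -> \tr (N *m Y) = 0) -> exists c, N = c%:M.
Proof.
move=> Nsl.
have off i j : i != j -> N i j = 0.
  move=> ij; rewrite -mxtrace_mul_delta Nsl // mem_sl -[delta_mx _ _]mul1mx.
  by rewrite mxtrace_mul_delta mxE (negbTE ij).
have diag i j : N i i = N j j.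
  have trB (M : 'M[F]_m) : \tr (M *m (delta_mx i i - delta_mx j j)) = M i i - M j j.
    by rewrite mulmxBr raddfB /= !mxtrace_mul_delta.
  apply/eqP; rewrite -subr_eq0 -trB Nsl // mem_sl -[_ - _]mul1mx trB.
  by rewrite !mxE !eqxx subrr.
case: (posnP m) => [m0|m_gt0].
  by exists 0; apply/matrixP=> -[i im]; exfalso; move: im; rewrite m0.
exists (N (Ordinal m_gt0) (Ordinal m_gt0)); apply/matrixP=> i j.
rewrite mxE; case: eqVneq => [<-|/off -> //].
by rewrite mulr1n; apply: diag.
Qed.

(** The kernel of the trace form is the line of scalars of End(V), and the
    identity of V, extended by 0 on constant vectors, is the centering matrix. *)
Lemma trace_form_eq0 Z :
  zero_sum Z -> trace_form Z = 0 -> exists c, Z = c *: centering.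
Proof.
move=> /zero_sum_center ZE tZ.
have [Y Ysl|c Nc] := @scalar_of_trace_orthogonal (weight *m Z *m root).
  by rewrite trace_formE // tZ big1 // => i _; rewrite mxE mul0r.
exists c; rewrite -ZE -root_weight -[RHS]mulmx1 -!mulmxA [weight *m (Z *m _)]mulmxA.
rewrite [weight *m Z *m _]mulmxA Nc mul_scalar_mx -scalemxAr -!scalemxAl.
by rewrite mulmx1.
Qed.

Lemma trace_form_surj w : exists2 Z, zero_sum Z & trace_form Z = w.
Proof.
(* phi is the functional with coordinates w, extended to all matrices, and N
   represents it for the trace. *)
pose phi Y := \sum_i w 0 i * coord (vbasis sl) i Y.
pose N : 'M[F]_m := \matrix_(j, i) phi (delta_mx i j).
have NE Y : \tr (N *m Y) = phi Y.
  rewrite {1}[Y]matrix_sum_delta mulmx_sumr raddf_sum /=.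
  under eq_bigr => i _ do rewrite mulmx_sumr raddf_sum /=.
  under eq_bigr => i _ do under eq_bigr => j _ do
    rewrite -scalemxAr mxtraceZ mxtrace_mul_delta mxE /phi mulr_sumr.
  rewrite /phi; under eq_bigr => i _ do rewrite exchange_big.
  rewrite exchange_big; apply: eq_bigr => k _ /=.
  rewrite [Y in RHS]matrix_sum_delta !linear_sum /= mulr_sumr.
  apply: eq_bigr => i _; rewrite linear_sum mulr_sumr; apply: eq_bigr => j _.
  by rewrite linearZ /= mulrCA.
exists (root *m N *m weight).
  split; first by rewrite -mulmxA weight_ones mulmx0.
  by rewrite !mulmxA ones_root !mul0mx.
apply/rowP=> i; rewrite mxE !mulmxA weight_root mul1mx -[_ *m weight *m _]mulmxA weight_root.
rewrite mulmx1 NE /phi (bigD1 i) //= big1 => [|j ji].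
  by rewrite coord_free ?(basis_free (vbasisP _)) // eqxx mulr1 addr0.
by rewrite coord_free ?(basis_free (vbasisP _)) // eq_sym (negbTE ji) mulr0.
Qed.

(** The criterion by which all similarities are obtained: a map that is
    equivariant, injective and surjective modulo the centering matrix becomes
    bijective when composed with the trace form, and equality of the dimensions
    follows. *)
Lemma conj_repr_rsim d (r : mx_representation F [set: 'S_n]%G d)
    (f : {linear 'rV[F]_d -> 'M[F]_n}) :
    (forall u g, f (u *m r g) = (P g)^T *m f u *m P g) ->
    (forall u, zero_sum (f u)) ->
    (forall u c, f u = c *: centering -> u = 0) ->
    (forall Z, zero_sum Z -> exists u c, Z = f u + c *: centering) ->
  mx_rsim (conj_repr F m) r.
Proof.
move=> fJ f0 f_inj f_surj; apply: mx_rsim_sym.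
pose B := lin1_mx (trace_form \o f).
have BE u : u *m B = trace_form (f u) by rewrite mul_rV_lin1.
have c0 : trace_form centering = 0.
  apply/rowP=> i; rewrite !mxE weight_center weight_root mul1mx.
  by apply/eqP; rewrite -mem_sl vbasis_sl.
have Bfree : row_free B.
  apply: inj_row_free => u; rewrite BE => /(trace_form_eq0 (f0 u))[c].
  exact: f_inj.
have Bfull : row_full B.
  rewrite -sub1mx; apply/row_subP=> i.
  have [Z /f_surj[u [c ->]] <-] := trace_form_surj (row i 1%:M).
  by rewrite linearD linearZ /= c0 scaler0 addr0 -BE submxMl.
apply: (MxReprSim (B := B)) => //.
  by rewrite -(eqP Bfree) (eqP Bfull).
move=> g _; apply/row_matrixP=> i; rewrite !row_mul.
by rewrite BE rowE fJ -trace_form_conj -BE -rowE.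
Qed.

End TraceForm.

(** * Splitting the matrices with zero row and column sums *)

Section ZeroSumPieces.
Variables (F : numFieldType) (m : nat).
Local Notation n := m.+1.
Local Notation P g := (perm_mx g : 'M[F]_n).
Local Notation centering := (centering_mx F m).
Implicit Types (Z : 'M[F]_n) (v : 'rV[F]_n).

Lemma perm_conjE Z (g : 'S_n) i j :
  ((P g)^T *m Z *m P g) i j = Z (g^-1 i)%g (g^-1 j)%g.
Proof.
by rewrite tr_perm_mx -row_permE -{2}[g]invgK -col_permE !mxE.
Qed.

Lemma zero_sum0 : zero_sum (0 : 'M[F]_n).
Proof. by split; rewrite ?mulmx0 ?mul0mx. Qed.

Lemma zero_sumD Z1 Z2 : zero_sum Z1 -> zero_sum Z2 -> zero_sum (Z1 + Z2).
Proof. by move=> [r1 c1] [r2 c2]; split; rewrite ?mulmxDl ?mulmxDr ?r1 ?r2 ?c1 ?c2 addr0. Qed.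

Lemma zero_sumZ a Z : zero_sum Z -> zero_sum (a *: Z).
Proof. by move=> [r1 c1]; split; rewrite -?scalemxAl -?scalemxAr ?r1 ?c1 scaler0. Qed.

Lemma zero_sumB Z1 Z2 : zero_sum Z1 -> zero_sum Z2 -> zero_sum (Z1 - Z2).
Proof. by move=> h1 h2; rewrite -scaleN1r; apply/zero_sumD/zero_sumZ. Qed.

Lemma zero_sum_tr Z : zero_sum Z -> zero_sum Z^T.
Proof. by move=> [r1 c1]; split; apply: trmx_inj; rewrite trmx_mul trmxK trmx_const trmx0. Qed.

Lemma zero_sum_row Z i : zero_sum Z -> \sum_j Z i j = 0.
Proof.
move=> [/colP/(_ i)]; rewrite !mxE => e _; rewrite -[RHS]e.
by apply: eq_bigr => j _; rewrite mxE mulr1.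
Qed.

Lemma zero_sum_sym Z : Z^T = Z -> (forall i, \sum_j Z i j = 0) -> zero_sum Z.
Proof.
move=> Zt Zr; have r : Z *m (const_mx 1 : 'cV_n) = 0.
  apply/colP=> i; rewrite !mxE -[RHS](Zr i).
  by apply: eq_bigr => j _; rewrite mxE mulr1.
by split=> //; apply: trmx_inj; rewrite trmx_mul Zt trmx_const trmx0.
Qed.

Lemma centering_tr : centering^T = centering.
Proof. by rewrite /centering_mx linearB /= trmx1 trmx_const. Qed.

Lemma centering_zero_sum : zero_sum centering.
Proof.
apply: zero_sum_sym centering_tr _.
move=> i; have /colP/(_ i) := center_ones F m; rewrite !mxE => {2}<-.
by apply: eq_bigr => j _; rewrite [const_mx 1 j 0]mxE mulr1.
Qed.

Lemma sum_zeroP v : reflect (\sum_i v 0 i = 0) (v <= sum_zero F n)%MS.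
Proof.
apply: (iffP sub_kermxP) => [/rowP/(_ 0)|e].
  rewrite !mxE => e; rewrite -[RHS]e.
  by apply: eq_bigr => j _; rewrite mxE mulr1.
apply/rowP=> i; rewrite ord1 !mxE -[RHS]e.
by apply: eq_bigr => j _; rewrite mxE mulr1.
Qed.

(** The symmetric matrix with entry v_i + v_j at i <> j, the diagonal being forced
    by the vanishing of the row sums when v has sum 0: it spreads a function on
    vertices over the edges. *)
Definition vertex_form v : 'M[F]_n :=
  \matrix_(i, j) (v 0 i + v 0 j - (v 0 i *+ n) *+ (i == j)).

Lemma vertex_form_is_linear : linear vertex_form.
Proof.
move=> a v w; apply/matrixP=> i j; rewrite !mxE !mulrnDl.
by case: (i == j); rewrite /= ?mulr1n ?mulr0n -?mulrnAr; ring.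
Qed.
HB.instance Definition _ :=
  GRing.isLinear.Build F 'rV[F]_n 'M[F]_n _ vertex_form vertex_form_is_linear.

Lemma vertex_formJ v g : vertex_form (v *m P g) = (P g)^T *m vertex_form v *m P g.
Proof.
apply/matrixP=> i j; rewrite perm_conjE -{1}[g]invgK -col_permE !mxE.
by rewrite (inj_eq perm_inj).
Qed.

Lemma vertex_form_tr v : (vertex_form v)^T = vertex_form v.
Proof.
apply/matrixP=> i j; rewrite !mxE [v 0 j + _]addrC eq_sym.
by case: eqVneq => [->|].
Qed.

(** The coefficient 2 - n is nonzero for n >= 3, so that v can be read off the
    diagonal. *)
Lemma vertex_form_diag v i : vertex_form v i i = (2 - n%:R) * v 0 i.
Proof. by rewrite mxE eqxx mulr1n -mulr_natl; ring. Qed.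

Lemma vertex_form_zero_sum v : (v <= sum_zero F n)%MS -> zero_sum (vertex_form v).
Proof.
move=> /sum_zeroP v0; apply: zero_sum_sym (vertex_form_tr v) _ => i.
under eq_bigr do rewrite mxE.
rewrite sumrB big_split /= v0 addr0 sumr_const card_ord.
rewrite (bigD1 i) //= eqxx mulr1n big1 => [|j]; first by rewrite addr0 subrr.
by rewrite eq_sym => /negbTE ->.
Qed.

Local Notation S := (sum_zero F n).
Local Notation std := (standard_repr F n).
Local Notation ext := (exterior2_repr std).
Local Notation E := (val_submod (1%:M : 'M_(\rank S))).

Lemma std_basisJ g : E *m P g = std g *m E.
Proof.
have := val_submodJ (sum_zero_module F n) 1%:M (in_setT g).
by rewrite mul1mx => <-; rewrite -val_submodE.
Qed.

(** An antisymmetric tensor in coordinates on a basis of the sum-zero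
    hyperplane, rewritten as an n x n matrix. *)
Definition ext_form (u : 'rV[F]_(\rank (antisym F (\rank S)))) : 'M[F]_n :=
  E^T *m vec_mx (val_submod u) *m E.

Lemma ext_form_is_linear : linear ext_form.
Proof. by move=> a u w; rewrite /ext_form !linearP /= mulmxDl -scalemxAl. Qed.
HB.instance Definition _ := GRing.isLinear.Build F
  'rV[F]_(\rank (antisym F (\rank S))) 'M[F]_n _ ext_form ext_form_is_linear.

Lemma ext_formJ u g : ext_form (u *m ext g) = (P g)^T *m ext_form u *m P g.
Proof.
rewrite /ext_form (val_submodJ (antisym_module std) _ (in_setT g)).
rewrite -[val_submod u]vec_mxK tensor2_mxE !mxvecK.
move: (std_basisJ g); move: (E) (std g : 'M_(\rank S)) => e r eJ.
by rewrite !mulmxA -trmx_mul -eJ -mulmxA -eJ trmx_mul !mulmxA.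
Qed.

Lemma ext_form_zero_sum u : zero_sum (ext_form u).
Proof.
have E0 : E *m const_mx 1 = 0 :> 'cV[F]__ by apply/sub_kermxP/val_submodP.
rewrite /ext_form; move: (E) E0 => b b0; split; first by rewrite -(mulmxA _ b) b0 mulmx0.
have -> : (const_mx 1 : 'rV_n) *m (b^T *m vec_mx (val_submod u) *m b) =
    (b *m (const_mx 1 : 'cV_n))^T *m vec_mx (val_submod u) *m b.
  by rewrite trmx_mul trmx_const !mulmxA.
by rewrite b0 trmx0 !mul0mx.
Qed.

Lemma ext_form_tr u : (ext_form u)^T = - ext_form u.
Proof.
have := val_submodP u; rewrite -{1}[val_submod u]vec_mxK mem_antisym => /eqP e.
by rewrite /ext_form; move: (E) => b; rewrite !trmx_mul trmxK e mulNmx mulmxN mulmxA.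
Qed.

Lemma ext_form_eq0 u : ext_form u = 0 -> u = 0.
Proof.
have Efree : row_free E.
  by rewrite /row_free val_submod1.
have /row_freeP[E'] := Efree; rewrite /ext_form; move: (E) => b bE'.
move=> /(congr1 (fun X => E'^T *m X *m E')).
rewrite !mulmxA -trmx_mul -!mulmxA bE' mulmx1 trmx1 mul1mx.
rewrite mul0mx mulmx0 => /(congr1 mxvec); rewrite vec_mxK linear0 => /eqP.
by rewrite val_submod_eq0 => /eqP.
Qed.

Lemma ext_form_surj Z :
  zero_sum Z -> Z^T = - Z -> exists u, ext_form u = Z.
Proof.
move=> [Zr _] Zt.
have [E' ZE] : exists E', Z *m E' *m E = Z.
  have ZS : (Z <= S)%MS by apply/sub_kermxP.
  by exists (in_submod S 1%:M); rewrite -in_submodE -val_submodE in_submodK.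
pose M := E'^T *m Z *m E'.
have Mt : M^T = - M by rewrite !trmx_mul trmxK Zt mulNmx mulmxN mulmxA.
exists (in_submod _ (mxvec M)).
rewrite /ext_form in_submodK ?mem_antisym ?Mt // mxvecK /M.
move: (E) ZE => b ZE.
have -> : b^T *m (E'^T *m Z *m E') *m b = (E' *m b)^T *m (Z *m E' *m b).
  by rewrite trmx_mul !mulmxA.
by rewrite ZE -[X in _ *m X]opprK -Zt mulmxN -trmx_mul mulmxA ZE Zt opprK.
Qed.

(** Equivalently, the functions on the edges of the complete graph whose sum
    around each vertex is 0. *)
Definition is_edge_form Z : Prop :=
  [/\ zero_sum Z, Z^T = Z & forall i, Z i i = 0].

Hypothesis m_gt1 : (1 < m)%N.

Let n2 : 2 - n%:R != 0 :> F.
Proof. by rewrite subr_eq0 eqr_nat; apply/eqP; lia. Qed.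

(** The antisymmetric part of Z gives u.  The trace of the symmetric part
    determines c; what remains of its diagonal then has sum 0, hence is
    the diagonal of a vertex form. *)
Lemma zero_sum_decomposition Z : zero_sum Z ->
  exists v u c Z0, [/\ (v <= S)%MS, is_edge_form Z0 &
    Z = vertex_form v + (ext_form u + Z0) + c *: centering].
Proof.
move=> Zz; pose A := 2^-1 *: (Z - Z^T); pose B := 2^-1 *: (Z + Z^T).
have AB : Z = A + B.
  by apply/matrixP=> i j; rewrite !mxE; field.
have Zt := zero_sum_tr Zz.
have [u uA] : exists u, ext_form u = A.
  apply: ext_form_surj; first exact/zero_sumZ/zero_sumB.
  by apply/matrixP=> i j; rewrite !mxE; ring.
have Bz : zero_sum B by apply/zero_sumZ/zero_sumD.
have Bt : B^T = B by apply/matrixP=> i j; rewrite !mxE addrC.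
clearbody B; have m0 : m%:R != 0 :> F by rewrite pnatr_eq0; lia.
have n0 := natn_neq0 F m.
pose c := \tr B / m%:R.
have cE i : centering i i = m%:R / n%:R.
  rewrite !mxE eqxx mulr1n; apply: (mulIf n0).
  by rewrite mulrBl mul1r mulVf // divfK // -[n]addn1 natrD addrK.
pose v := \row_i ((B i i - c * (m%:R / n%:R)) / (2 - n%:R)) : 'rV[F]_n.
have vS : (v <= S)%MS.
  apply/sum_zeroP; under eq_bigr do rewrite mxE.
  rewrite -mulr_suml sumrB -/(\tr B) sumr_const card_ord -[_ *+ n]mulr_natr /c.
  by rewrite mulrA divfK // divfK // subrr mul0r.
exists v, u, c, (B - vertex_form v - c *: centering); split=> //; last first.
  by rewrite uA {1}AB -addrA -addrA; apply/matrixP=> i j; rewrite !mxE; ring.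
split.
- apply: zero_sumB; last exact/zero_sumZ/centering_zero_sum.
  by apply: zero_sumB => //; apply: vertex_form_zero_sum.
- have trB (X Y : 'M[F]_n) : (X - Y)^T = X^T - Y^T := linearB _ X Y.
  by rewrite 2!trB linearZ /= Bt vertex_form_tr centering_tr.
- move=> i.
  have -> : forall X Y : 'M[F]_n, (B - X - c *: Y) i i = B i i - X i i - c * Y i i.
    by move=> X Y; rewrite !mxE.
  rewrite vertex_form_diag cE [v 0 i]mxE [(2 - _) * _]mulrC divfK //.
  by rewrite subKr subrr.
Qed.

(** Only v contributes to the diagonal of the left-hand side, which therefore has
    sum 0, while that of the centering matrix is constant and nonzero: hence
    c = 0 and v = 0.  A matrix that is both symmetric and antisymmetric is 0. *)
Lemma zero_sum_independence v u c Z0 : (v <= S)%MS -> is_edge_form Z0 ->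
  vertex_form v + (ext_form u + Z0) = c *: centering -> [/\ v = 0, u = 0 & Z0 = 0].
Proof.
move=> /sum_zeroP v0 [_ Z0t Z0d] e; have n0 := natn_neq0 F m.
have ext_diag i : ext_form u i i = 0.
  have /matrixP/(_ i i) := ext_form_tr u; rewrite !mxE => /eqP.
  by rewrite -addr_eq0 -mulr2n mulrn_eq0 /= => /eqP.
have vE i : (2 - n%:R) * v 0 i = c * (1 - n%:R^-1).
  have /matrixP/(_ i i) := e.
  rewrite mxE vertex_form_diag mxE Z0d ext_diag !addr0 => ->.
  by rewrite !mxE eqxx.
have c0 : c * (1 - n%:R^-1) = 0.
  have : \sum_i (2 - n%:R) * v 0 i = 0 by rewrite -mulr_sumr v0 mulr0.
  under eq_bigr do rewrite vE; rewrite sumr_const card_ord => /eqP.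
  by rewrite mulrn_eq0 /= => /eqP.
have {}c0 : c = 0.
  apply/eqP; move/eqP: c0; rewrite mulf_eq0 => /orP[//|].
  by rewrite subr_eq0 eq_sym invr_eq1 pnatr_eq1 eqSS; lia.
have {vE}v0' : v = 0.
  apply/rowP=> i; apply: (mulfI n2).
  by rewrite vE c0 mul0r mxE mulr0.
move: e; rewrite v0' c0 scale0r linear0 add0r => e.
have Z00 : Z0 = 0.
  have := congr1 trmx e; rewrite linearD /= ext_form_tr Z0t trmx0 => e'.
  have : (ext_form u + Z0) + (- ext_form u + Z0) = 0 by rewrite e e' addr0.
  rewrite addrACA subrr add0r -mulr2n => /matrixP ZZ.
  apply/matrixP=> i j; have := ZZ i j; rewrite !mxE => /eqP.
  by rewrite -mulr2n mulrn_eq0 /= => /eqP.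
by split=> //; apply: ext_form_eq0; move: e; rewrite Z00 addr0.
Qed.

End ZeroSumPieces.

(** * From equivariant maps to a direct sum decomposition *)

Section DirectSumAction.
Variables (F : numFieldType) (m : nat).
Local Notation n := m.+1.
Local Notation G := [set: 'S_n]%G.

Definition conj_equivariant d (r : mx_representation F G d)
    (f : 'rV[F]_d -> 'M[F]_n) : Prop :=
  forall u g, f (u *m r g) = (perm_mx g)^T *m f u *m perm_mx g.

Definition dadd_form d1 d2 (f1 : 'rV[F]_d1 -> 'M[F]_n) (f2 : 'rV[F]_d2 -> 'M[F]_n)
    (u : 'rV[F]_(d1 + d2)) : 'M[F]_n :=
  f1 (lsubmx u) + f2 (rsubmx u).

Lemma dadd_form_equivariant (r1 r2 : representation F G)
    (f1 : 'rV[F]_(rdegree r1) -> 'M[F]_n) (f2 : 'rV[F]_(rdegree r2) -> 'M[F]_n) :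
  conj_equivariant r1 f1 -> conj_equivariant r2 f2 ->
  conj_equivariant (dadd_grepr r1 r2) (dadd_form f1 f2).
Proof.
move=> f1J f2J u g; rewrite /dadd_form.
rewrite -{1 2}[u]hsubmxK [_ *m _]mul_row_block row_mxKl row_mxKr.
by rewrite !mulmx0 addr0 add0r f1J f2J mulmxDr mulmxDl.
Qed.

Lemma dadd_form_is_linear d1 d2 (f1 : {linear 'rV[F]_d1 -> 'M[F]_n})
    (f2 : {linear 'rV[F]_d2 -> 'M[F]_n}) : linear (dadd_form f1 f2).
Proof. by move=> a u w; rewrite /dadd_form !linearP scalerDr addrACA. Qed.
HB.instance Definition _ d1 d2 (f1 : {linear 'rV[F]_d1 -> 'M[F]_n})
    (f2 : {linear 'rV[F]_d2 -> 'M[F]_n}) :=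
  GRing.isLinear.Build F 'rV[F]_(d1 + d2) 'M[F]_n _ (dadd_form f1 f2)
    (dadd_form_is_linear f1 f2).

End DirectSumAction.

Section Decomposition.
Variables (F : numFieldType) (m : nat).
Hypothesis m_gt1 : (1 < m)%N.
Local Notation n := m.+1.
Local Notation P g := (perm_mx g : 'M[F]_n).
Local Notation G := [set: 'S_n]%G.
Local Notation std := (standard_repr F n).
Local Notation ext := (exterior2_repr std).
Local Notation S := (sum_zero F n).

Let std_form : {linear 'rV[F]_(\rank S) -> 'M[F]_n} :=
  @vertex_form F m \o @val_submod F n S 1.

Let std_formJ : conj_equivariant std std_form.
Proof.
move=> u g; rewrite /= (val_submodJ (sum_zero_module F n) _ (in_setT g)).
exact: vertex_formJ.
Qed.

(** The representation r stands for a model of the symmetric matrices with zero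
    diagonal and zero row sums. *)
Lemma conj_repr_decomposition d (r : mx_representation F G d)
    (f : {linear 'rV[F]_d -> 'M[F]_n}) :
    conj_equivariant r f ->
    (forall u, is_edge_form (f u)) -> (forall u, f u = 0 -> u = 0) ->
    (forall Z, is_edge_form Z -> exists u, f u = Z) ->
  mx_rsim (conj_repr F m)
    (dadd_grepr (Representation std)
       (dadd_grepr (Representation ext) (Representation r))).
Proof.
move=> fJ fe f_inj f_surj.
pose h : {linear 'rV[F]_(\rank S + (\rank (antisym F (\rank S)) + d)) -> 'M[F]_n} :=
  dadd_form std_form (dadd_form (@ext_form F m) f).
have hE u : h u = vertex_form (val_submod (lsubmx u)) +
  (ext_form (lsubmx (rsubmx u)) + f (rsubmx (rsubmx u))) by [].
apply: (conj_repr_rsim (f := h)) => [|u|u c|Z Zz].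
- apply: (dadd_form_equivariant (r1 := Representation std)
    (r2 := dadd_grepr (Representation ext) (Representation r))) => //.
  apply: (dadd_form_equivariant (r1 := Representation ext)
    (r2 := Representation r)) => //.
  exact: ext_formJ.
- rewrite hE; apply: zero_sumD; first exact/vertex_form_zero_sum/val_submodP.
  by apply: zero_sumD; [apply: ext_form_zero_sum | case: (fe (rsubmx (rsubmx u)))].
- rewrite hE => /(zero_sum_independence m_gt1 (val_submodP _) (fe _))[/eqP + u2 u3].
  rewrite val_submod_eq0 => /eqP u1.
  by rewrite -[u]hsubmxK -[rsubmx u]hsubmxK u1 u2 (f_inj _ u3) !row_mx0.
have [v [u2 [c [Z0 [vS /f_surj[u3 <-] ->]]]]] := zero_sum_decomposition m_gt1 Zz.
exists (row_mx (in_submod S v) (row_mx u2 u3)), c.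
by rewrite hE !(row_mxKl, row_mxKr) in_submodK.
Qed.

Lemma conj_repr_decomposition0 :
    (forall Z : 'M[F]_n, is_edge_form Z -> Z = 0) ->
  mx_rsim (conj_repr F m)
    (dadd_grepr (Representation std) (Representation ext)).
Proof.
move=> edge0; pose h : {linear 'rV[F]_(\rank S + \rank (antisym F (\rank S))) -> 'M[F]_n} :=
  dadd_form std_form (@ext_form F m).
have e0 : is_edge_form (0 : 'M[F]_n).
  by split=> [||i]; [apply: zero_sum0 | apply: trmx0 | rewrite mxE].
have hE u : h u = vertex_form (val_submod (lsubmx u)) + ext_form (rsubmx u) by [].
apply: (conj_repr_rsim (f := h)) => [|u|u c|Z Zz].
- apply: (dadd_form_equivariant (r1 := Representation std)
    (r2 := Representation ext)) => //.
  exact: ext_formJ.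
- rewrite hE; apply: zero_sumD; first exact/vertex_form_zero_sum/val_submodP.
  exact: ext_form_zero_sum.
- rewrite hE -[ext_form _]addr0.
  move=> /(zero_sum_independence m_gt1 (val_submodP _) e0)[/eqP + u2 _].
  rewrite val_submod_eq0 => /eqP u1.
  by rewrite -[u]hsubmxK u1 u2 row_mx0.
have [v [u2 [c [Z0 [vS /edge0 -> ->]]]]] := zero_sum_decomposition m_gt1 Zz.
exists (row_mx (in_submod S v) u2), c.
by rewrite hE !(row_mxKl, row_mxKr) in_submodK ?addr0.
Qed.

End Decomposition.

(** In a triangle any two edges meet at a vertex, so that the weights of any two
    edges have sum 0. *)
Lemma edge_form3_eq0 (F : numFieldType) (Z : 'M[F]_3) : is_edge_form Z -> Z = 0.
Proof.
move=> [Zz Zt Zd]; have tE i j : Z i j = Z j i by rewrite -{1}Zt mxE.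
have r0 := zero_sum_row ord0 Zz; have r1 := zero_sum_row (lift ord0 ord0) Zz.
have r2 := zero_sum_row (lift ord0 (lift ord0 ord0)) Zz.
move: r0 r1 r2; rewrite !big_ord_recl !big_ord0 !Zd !addr0 !add0r.
set o1 := lift ord0 ord0; set o2 := lift ord0 (lift ord0 ord0).
rewrite !(tE o2) (tE o1) => r0 r1 r2.
have two (x : F) : x *+ 2 = 0 -> x = 0 by move/eqP; rewrite mulrn_eq0 => /eqP.
have z01 : Z ord0 o1 = 0.
  apply: two; transitivity ((Z ord0 o1 + Z ord0 o2) + (Z ord0 o1 + Z o1 o2)
      - (Z ord0 o2 + Z o1 o2)); first by ring.
  by rewrite r0 r1 r2 addr0 subrr.
have z02 : Z ord0 o2 = 0 by rewrite -r0 z01 add0r.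
have z12 : Z o1 o2 = 0 by rewrite -r1 z01 add0r.
have ords (i : 'I_3) : [\/ i = ord0, i = o1 | i = o2].
  case: i => [[|[|[|]]]] // h; [apply: Or31|apply: Or32|apply: Or33]; exact: val_inj.
apply/matrixP=> i j; rewrite mxE.
by case: (ords i) => ->; case: (ords j) => ->; rewrite ?Zd // tE.
Qed.

(** * Symmetric matrices with zero diagonal and zero row sums *)

Section EdgeForms.
Variables (F : numFieldType) (m : nat).
Local Notation n := m.+1.
Local Notation P g := (perm_mx g : 'M[F]_n).
Implicit Types (Z : 'M[F]_n) (a b c d x y : 'I_n).

Definition edge_mx a b : 'M[F]_n := delta_mx a b + delta_mx b a.

(** The alternating 4-cycle a, b, c, d. *)
Definition cross_mx a b c d : 'M[F]_n :=
  edge_mx a b - edge_mx c b - edge_mx a d + edge_mx c d.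

Lemma delta_mxJ (g : 'S_n) a b :
  (P g)^T *m delta_mx a b *m P g = delta_mx (g a) (g b).
Proof.
apply/matrixP=> i j; rewrite perm_conjE !mxE.
by rewrite -{1}[a](permK g) -{1}[b](permK g) !(inj_eq perm_inj).
Qed.

Lemma edge_mxJ (g : 'S_n) a b :
  (P g)^T *m edge_mx a b *m P g = edge_mx (g a) (g b).
Proof. by rewrite /edge_mx mulmxDr mulmxDl !delta_mxJ. Qed.

Lemma cross_mxJ (g : 'S_n) a b c d :
  (P g)^T *m cross_mx a b c d *m P g = cross_mx (g a) (g b) (g c) (g d).
Proof.
have JD X Y : (P g)^T *m (X + Y) *m P g = (P g)^T *m X *m P g + (P g)^T *m Y *m P g.
  by rewrite mulmxDr mulmxDl.
have JB X Y : (P g)^T *m (X - Y) *m P g = (P g)^T *m X *m P g - (P g)^T *m Y *m P g.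
  by rewrite mulmxBr mulmxBl.
by rewrite /cross_mx JD 2!JB !edge_mxJ.
Qed.

Lemma edge_mx_row a b i : \sum_j edge_mx a b i j = (i == a)%:R + (i == b)%:R.
Proof.
have S (k l : 'I_n) : \sum_j (delta_mx k l : 'M[F]_n) i j = (i == k)%:R.
  rewrite (bigD1 l) //= mxE eqxx andbT big1 ?addr0 // => j jl.
  by rewrite mxE (negbTE jl) andbF.
by under eq_bigr do rewrite mxE; rewrite big_split /= !S.
Qed.

Lemma cross_mx_edge a b c d : uniq [:: a; b; c; d] -> is_edge_form (cross_mx a b c d).
Proof.
rewrite /= !inE !negb_or => /and4P[/and3P[ab ac ad] /andP[bc bd] cd _].
have tr : (cross_mx a b c d)^T = cross_mx a b c d.
  by apply/matrixP=> i j; rewrite !mxE ![(j == _) && _]andbC; ring.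
split=> //.
  apply: zero_sum_sym tr _ => i.
  transitivity (\sum_j edge_mx a b i j - \sum_j edge_mx c b i j -
      \sum_j edge_mx a d i j + \sum_j edge_mx c d i j).
    by rewrite -!sumrB -big_split; apply: eq_bigr => j _; rewrite !mxE.
  rewrite !edge_mx_row; ring.
have off (k l i : 'I_n) : k != l -> edge_mx k l i i = 0.
  move=> kl; rewrite !mxE; case: (eqVneq i k) => [->|_]; last by rewrite andbF addr0.
  by rewrite (negbTE kl) addr0.
move=> i; transitivity (edge_mx a b i i - edge_mx c b i i -
  edge_mx a d i i + edge_mx c d i i); first by rewrite !mxE.
by rewrite !off // 1?eq_sym // !subr0 addr0.
Qed.

Lemma sum_notin (f : 'I_n -> F) (s : seq 'I_n) : uniq s ->
  \sum_(i | i \notin s) f i = \sum_i f i - \sum_(i <- s) f i.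
Proof.
move=> us; rewrite [X in X - _](bigID (mem s)) /= big_uniq //=.
by rewrite addrAC subrr add0r.
Qed.

(** Inclusion-exclusion for the sum over b outside a, x and y. *)
Lemma sum_uniq4 (h : 'I_n -> 'I_n -> F) x y : x != y ->
  \sum_a \sum_b (uniq [:: a; b; x; y])%:R * h a b =
  \sum_(a | a \notin [:: x; y])
    (\sum_b h a b - (h a a + (h a x + h a y))).
Proof.
move=> xy; rewrite [RHS]big_mkcond; apply: eq_bigr => a _.
case: ifP => axy.
  transitivity (\sum_(b | b \notin [:: a; x; y]) h a b).
    rewrite [RHS]big_mkcond /=; apply: eq_bigr => b _.
    move: axy; rewrite /= !inE !negb_or xy [b == a]eq_sym => /andP[-> ->].
    by case: (a == b); case: (b == x); case: (b == y); rewrite /= ?mul0r ?mul1r.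
  rewrite sum_notin; first by rewrite !big_cons big_nil addr0.
  by rewrite /= axy inE xy.
rewrite big1 // => b _; rewrite (_ : uniq _ = false) ?mul0r //=.
by move: axy; rewrite !inE !negb_or; case: (a == x); case: (a == y); rewrite //= andbF.
Qed.

Lemma sum_pick (f : 'I_n -> F) x : \sum_a f a * (x == a)%:R = f x.
Proof.
rewrite (bigD1 x) //= eqxx mulr1 big1 ?addr0 // => a.
by rewrite eq_sym => /negbTE ->; rewrite mulr0.
Qed.

Let uniq4C x y a b : uniq [:: x; y; a; b] = uniq [:: a; b; x; y].
Proof. by apply: perm_uniq; apply/seq.permP=> p /=; lia. Qed.
Let uniq4S x y a b : uniq [:: a; y; x; b] = uniq [:: a; b; x; y].
Proof. by apply: perm_uniq; apply/seq.permP=> p /=; lia. Qed.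
Let uniq4T x y a b : uniq [:: x; a; b; y] = uniq [:: a; b; x; y].
Proof. by apply: perm_uniq; apply/seq.permP=> p /=; lia. Qed.

Let w Z a b c d : F := (uniq [:: a; b; c; d])%:R * Z a b.

Let sum_notin2 (g : 'I_n -> F) x y : x != y ->
  \sum_(a | a \notin [:: x; y]) g a = \sum_a g a - g x - g y.
Proof.
move=> xy; rewrite sum_notin /=; last by rewrite inE xy.
by rewrite !big_cons big_nil addr0 opprD addrA.
Qed.

Let sum_cst (z : F) : \sum_(i < n) z = n%:R * z.
Proof. by rewrite sumr_const card_ord mulr_natl. Qed.

Let zero_sum_col Z x : is_edge_form Z -> \sum_a Z a x = 0.
Proof.
move=> [Zz Zt _]; rewrite -[RHS](zero_sum_row x Zz); apply: eq_bigr => a _.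
by rewrite -{1}Zt mxE.
Qed.

(** In each sum the free indices avoid x, y and each other.  The first sum counts
    the choices of c and d.  In the others, since the rows and columns of Z sum
    to 0 and its diagonal vanishes, a sum of entries over the allowed indices is
    minus the sum over the few forbidden ones, which only involves the entry at
    (x, y) and its transpose. *)
Lemma edge_form_corner_sums Z x y : is_edge_form Z -> x != y ->
  [/\ \sum_c \sum_d w Z x y c d = (n%:R - 2) * (n%:R - 3) * Z x y,
      \sum_a \sum_d w Z a y x d = - (n%:R - 3) * Z x y,
      \sum_b \sum_c w Z x b c y = - (n%:R - 3) * Z x y &
      \sum_a \sum_b w Z a b x y = 2 * Z x y].
Proof.
move=> Ze xy; have [Zz Zt Zd] := Ze.
have Zsym i j : Z i j = Z j i by rewrite -{1}Zt mxE.
split.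
- transitivity (\sum_c \sum_d (uniq [:: c; d; x; y])%:R * Z x y).
    by do 2!apply: eq_bigr => ? _; rewrite /w uniq4C.
  rewrite (sum_uniq4 (fun _ _ => Z x y) xy) sum_notin2 // !sum_cst; ring.
- transitivity (\sum_a \sum_d (uniq [:: a; d; x; y])%:R * Z a y).
    by do 2!apply: eq_bigr => ? _; rewrite /w uniq4S.
  rewrite (sum_uniq4 (fun a _ => Z a y) xy) sum_notin2 //.
  under eq_bigr do rewrite sum_cst.
  rewrite sumrB -mulr_sumr big_split big_split /= !zero_sum_col // !sum_cst !Zd; ring.
- transitivity (\sum_b \sum_c (uniq [:: b; c; x; y])%:R * Z x b).
    by do 2!apply: eq_bigr => ? _; rewrite /w uniq4T.
  rewrite (sum_uniq4 (fun b _ => Z x b) xy) sum_notin2 //.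
  under eq_bigr do rewrite sum_cst.
  rewrite sumrB -mulr_sumr big_split big_split /= !(zero_sum_row x Zz) !sum_cst !Zd; ring.
rewrite (sum_uniq4 Z xy) sum_notin2 //.
under eq_bigr do rewrite (zero_sum_row _ Zz) Zd !add0r.
rewrite sumrN big_split /= !zero_sum_col // !(zero_sum_row _ Zz) !Zd (Zsym y x); ring.
Qed.

(** The upper half of the average of 4-cycles: a 4-cycle is the sum of the matrix
    in parentheses and of its transpose. *)
Definition corner_average Z : 'M[F]_n :=
  \sum_a \sum_b \sum_c \sum_d w Z a b c d *:
    (delta_mx a b - delta_mx c b - delta_mx a d + delta_mx c d).

(** The entry at (x, y) collects the four sums of [edge_form_corner_sums], with
    total coefficient (n-2)(n-3) + 2(n-3) + 2 = (n-1)(n-2). *)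
Lemma corner_averageE Z : is_edge_form Z ->
  corner_average Z = (m%:R * (m%:R - 1)) *: Z.
Proof.
move=> Ze; apply/matrixP=> x y.
have -> : corner_average Z x y =
    \sum_c \sum_d w Z x y c d - \sum_a \sum_d w Z a y x d
    - \sum_b \sum_c w Z x b c y + \sum_a \sum_b w Z a b x y.
  pose D a b : F := (x == a)%:R * (y == b)%:R.
  transitivity (\sum_a \sum_b \sum_c \sum_d
      w Z a b c d * (D a b - D c b - D a d + D c d)).
    do 4!(rewrite summxE; apply: eq_bigr => ? _).
    by rewrite /D !mxE -!natrM !mulnb.
  transitivity (\sum_a \sum_b \sum_c \sum_d w Z a b c d * D a b
      - \sum_a \sum_b \sum_c \sum_d w Z a b c d * D c b
      - \sum_a \sum_b \sum_c \sum_d w Z a b c d * D a d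
      + \sum_a \sum_b \sum_c \sum_d w Z a b c d * D c d).
    do 4!(rewrite -!sumrB -big_split /=; apply: eq_bigr => ? _).
    by rewrite mulrDr !mulrBr.
  congr (_ - _ - _ + _).
  - rewrite -[RHS](sum_pick (fun a => \sum_c \sum_d w Z a y c d)).
    apply: eq_bigr => a _; rewrite -(sum_pick (fun b => \sum_c \sum_d w Z a b c d)).
    do 3!(rewrite ?mulr_suml; apply: eq_bigr => ? _).
    by rewrite /D mulrA mulrAC.
  - apply: eq_bigr => a _; rewrite -[RHS](sum_pick (fun b => \sum_d w Z a b x d)).
    apply: eq_bigr => b _; rewrite -(sum_pick (fun c => \sum_d w Z a b c d)).
    do 2!(rewrite ?mulr_suml; apply: eq_bigr => ? _).
    by rewrite /D mulrA.
  - rewrite -[RHS](sum_pick (fun a => \sum_b \sum_c w Z a b c y)).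
    apply: eq_bigr => a _; do 2!(rewrite ?mulr_suml; apply: eq_bigr => ? _).
    rewrite -[in RHS](sum_pick (fun d => w Z a _ _ d)) mulr_suml.
    by apply: eq_bigr => d _; rewrite /D mulrA mulrAC.
  - apply: eq_bigr => a _; apply: eq_bigr => b _.
    rewrite -[RHS](sum_pick (fun c => w Z a b c y)).
    apply: eq_bigr => c _; rewrite -(sum_pick (fun d => w Z a b c d)) mulr_suml.
    by apply: eq_bigr => d _; rewrite /D mulrA mulrAC.
have [_ _ Zd] := Ze; rewrite mxE; have [<-|xy] := eqVneq x y.
  rewrite Zd mulr0 !big1 ?subr0 ?addr0 // => i _; rewrite big1 // => j _;
    by rewrite /w /= !inE eqxx ?orbT ?andbF mul0r.
have [-> -> -> ->] := edge_form_corner_sums Ze xy.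
have -> : n%:R = m%:R + 1 :> F by rewrite natr1.
ring.
Qed.

(** The factor is nonzero as soon as m > 1, so that the 4-cycles span. *)
Lemma edge_form_average Z : is_edge_form Z ->
  \sum_a \sum_b \sum_c \sum_d w Z a b c d *: cross_mx a b c d =
  (2 * m%:R * (m%:R - 1)) *: Z.
Proof.
move=> Ze; transitivity (corner_average Z + (corner_average Z)^T).
  rewrite /corner_average; do 4!(rewrite raddf_sum -big_split /=; apply: eq_bigr => ? _).
  rewrite linearZ /= -scalerDr; congr (_ *: _).
  by apply/matrixP=> i j; rewrite !mxE ![(j == _) && _]andbC; ring.
have [_ Zt _] := Ze.
by rewrite corner_averageE // linearZ /= Zt -scalerDl; congr (_ *: _); ring.
Qed.

End EdgeForms.

(** * The Specht module of shape (n-2, 2) *)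

Lemma cyclic_mx_span (F : fieldType) (gT : finGroupType) (G : {group gT}) d
    (r : mx_representation F G d) (u x : 'rV[F]_d) :
  (x <= cyclic_mx r u)%MS ->
  exists c : gT -> F, x = \sum_(g in G) c g *: (u *m r g).
Proof.
move=> /cyclic_mxP[A /envelop_mxP[c ->] ->]; exists c.
by rewrite mulmx_sumr; apply: eq_bigr => g _; rewrite scalemxAr.
Qed.

(** By induction: the image of the first element is corrected by a transposition,
    which moves none of the images already fixed. *)
Lemma perm_of_uniq (T : finType) (s t : seq T) :
  uniq s -> uniq t -> size s = size t -> exists g : {perm T}, map g s = t.
Proof.
elim: s t => [|x s IH] [|y t] //=; first by exists 1%g.
move=> /andP[xs us] /andP[yt ut] [/(IH _ us ut)[g gs]].
exists (g * tperm (g x) y)%g; rewrite permM tpermL; congr (_ :: _).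
rewrite -gs; apply/eq_in_map => z zs; rewrite permM tpermD //.
  by rewrite (inj_eq perm_inj); apply: contraNneq xs => ->.
by apply: contraNneq yt => ->; rewrite -gs map_f.
Qed.

Section SpechtModule.
Variables (F : numFieldType) (m : nat).
Hypothesis m_gt2 : (2 < m)%N.
Local Notation n := m.+1.
Local Notation P g := (perm_mx g : 'M[F]_n).
Local Notation lam := [:: (n - 2)%N; 2%N].
Local Notation tabloid := (tabloid n lam).
Local Notation tabloid_vec := (@tabloid_vec F n lam).
Local Notation u0 := (polytabloid F n lam).

Let np : (m.-1 < n)%N. Proof. lia. Qed.
Let n1 : (1 < n)%N. Proof. lia. Qed.
(* The columns of length 2 of the diagram are {o0, p} and {o1, q}. *)
Let p : 'I_n := Ordinal np.
Let q : 'I_n := ord_max.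
Let o0 : 'I_n := ord0.
Let o1 : 'I_n := Ordinal n1.

Let upq : uniq [:: p; q; o0; o1].
Proof. by rewrite /= !inE -!val_eqE /=; lia. Qed.

Let neqs : [/\ p != q, p != o0, p != o1 & [/\ q != o0, q != o1 & o0 != o1]].
Proof. by split; [..|split]; rewrite -val_eqE /=; lia. Qed.

Let reshape_indexE (i : 'I_n) : reshape_index lam i = (m.-1 <= i)%N.
Proof.
have := ltn_ord i; rewrite /reshape_index /=.
move=> im; have [h|h] := leqP m.-1 i; last by rewrite ifT //; apply/eqP; lia.
rewrite ifF; first by rewrite ifT //; apply/eqP; lia.
by apply/negbTE/eqP; lia.
Qed.

Lemma tab_rowE (i : 'I_n) : tab_row lam i = (m.-1 <= i)%N :> nat.
Proof. by rewrite /tab_row reshape_indexE inordK //; case: (m.-1 <= i)%N. Qed.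

Lemma tab_colE (i : 'I_n) : tab_col lam i = if (m.-1 <= i)%N then (i - m.-1)%N else i.
Proof.
by rewrite /tab_col /reshape_offset reshape_indexE; case: leqP => _ /=; lia.
Qed.

(** The tabloid to which [polytabloid] applies the column group. *)
Definition canonical_tabloid : tabloid := [ffun i => tab_row lam i].
Local Notation f0 := canonical_tabloid.

(** The edge formed by the second row of f or, if this row has another size, the
    complete graph on it: being defined for all row functions, it is equivariant
    without side condition. *)
Definition tabloid_form (f : tabloid) : 'M[F]_n :=
  \matrix_(a, b) [&& a != b, f a == 1%N :> nat & f b == 1%N :> nat]%:R.

Lemma tabloid_formJ f g :
  tabloid_form (tabloid_act f g) = (P g)^T *m tabloid_form f *m P g.
Proof.
by apply/matrixP=> a b; rewrite perm_conjE !mxE !ffunE (inj_eq perm_inj).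
Qed.

Lemma canonical_tabloidE (i : 'I_n) : f0 i = (i \in [:: p; q]) :> nat.
Proof.
rewrite ffunE tab_rowE !inE -!val_eqE /=; have := ltn_ord i.
by case: leqP => /=; lia.
Qed.

Let canonical_tabloid1 (i : 'I_n) : (f0 i == 1%N :> nat) = (i \in [:: p; q]).
Proof. by rewrite canonical_tabloidE eqb1. Qed.

Lemma canonical_tabloid_form : tabloid_form f0 = edge_mx F p q.
Proof.
have pq : p != q by rewrite -val_eqE /=; lia.
apply/matrixP=> a b; rewrite !mxE !canonical_tabloid1 !inE.
have [->|ap] := eqVneq a p.
  rewrite /= (negbTE pq) addr0; have [->|bp] := eqVneq b p; last by [].
  by rewrite (negbTE pq).
have [->|aq] := eqVneq a q; last by rewrite /= andbF addr0.
rewrite /= add0r; have [->|bq] := eqVneq b q; last by rewrite orbF.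
by rewrite eq_sym (negbTE pq).
Qed.

Definition tabloid_space_form (x : 'rV[F]_#|tabloid|) : 'M[F]_n :=
  \sum_k x 0 k *: tabloid_form (enum_val k).

Lemma tabloid_space_form_is_linear : linear tabloid_space_form.
Proof.
move=> a x y; rewrite /tabloid_space_form scaler_sumr -big_split /=.
by apply: eq_bigr => k _; rewrite !mxE scalerDl scalerA.
Qed.
HB.instance Definition _ := GRing.isLinear.Build F
  'rV[F]_#|tabloid| 'M[F]_n _ tabloid_space_form tabloid_space_form_is_linear.
Local Notation Theta := tabloid_space_form.

Lemma tabloid_vec_form f : Theta (tabloid_vec f) = tabloid_form f.
Proof.
rewrite /Theta (bigD1 (enum_rank f)) //= mxE !eqxx scale1r enum_rankK.
by rewrite big1 ?addr0 // => k kf; rewrite mxE (negbTE kf) andbF scale0r.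
Qed.

Lemma tabloid_space_formJ : conj_equivariant (tabloid_repr F n lam) Theta.
Proof.
move=> x g; rewrite [x in LHS]row_sum_delta mulmx_suml linear_sum /=.
rewrite [Theta x]/tabloid_space_form mulmx_sumr mulmx_suml; apply: eq_bigr => k _.
rewrite -scalemxAl linearZ /= -scalemxAr -scalemxAl -tabloid_formJ.
have -> : delta_mx 0 k = tabloid_vec (enum_val k).
  by rewrite /tabloid_vec enum_valK.
by rewrite -tabloid_vec_form; congr (_ *: Theta _); apply: tabloid_mxE.
Qed.

Let s : 'S_n := tperm o0 p.
Let t : 'S_n := tperm o1 q.

Lemma column_group_mem (g : 'S_n) i :
  g \in column_group n lam -> tab_col lam (g i) = tab_col lam i.
Proof. by rewrite inE => /forallP/(_ i)/eqP. Qed.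

Lemma column_groupM (g h : 'S_n) :
  g \in column_group n lam -> h \in column_group n lam ->
  (g * h)%g \in column_group n lam.
Proof.
move=> gC hC; rewrite inE; apply/forallP=> i.
by rewrite permM column_group_mem // column_group_mem.
Qed.

Let sC : s \in column_group n lam.
Proof.
rewrite inE; apply/forallP=> i; rewrite !tab_colE.
by rewrite /s /p; case: tpermP => [->|->|//] /=; apply/eqP; case: leqP => ?; case: leqP => ?; lia.
Qed.

Let tC : t \in column_group n lam.
Proof.
rewrite inE; apply/forallP=> i; rewrite !tab_colE.
by rewrite /t /q; case: tpermP => [->|->|//] /=; apply/eqP; case: leqP => ?; case: leqP => ?; lia.
Qed.

(** Only the first two columns have two cells, so an element of the column group
    is determined by the images of the first entries of these columns. *)
Lemma column_group_fix (g : 'S_n) :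
  g \in column_group n lam -> g o0 = o0 -> g o1 = o1 -> g = 1%g.
Proof.
move=> gC g0 g1; apply/permP=> i; rewrite perm1.
have := column_group_mem i gC; rewrite !tab_colE => e.
have ne0 : i != o0 -> g i != o0 by move=> h; rewrite -g0 (inj_eq perm_inj).
have ne1 : i != o1 -> g i != o1 by move=> h; rewrite -g1 (inj_eq perm_inj).
have [->|i0] := eqVneq i o0; first exact: g0.
have [->|i1] := eqVneq i o1; first exact: g1.
have a := ne0 i0; have b := ne1 i1; rewrite -!val_eqE /o0 /o1 /= in a b i0 i1.
have gn := ltn_ord (g i); have im := ltn_ord i.
by move: e; case: leqP => ?; case: leqP => ? e; apply: val_inj => /=; lia.
Qed.

Let sE : [/\ s o0 = p, s o1 = o1, s p = o0 & s q = q].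
Proof.
have [? ? ? [? ? ?]] := neqs.
by rewrite /s tpermL tpermR !tpermD // eq_sym.
Qed.

Let tE : [/\ t o0 = o0, t o1 = q, t p = p & t q = o1].
Proof.
have [? ? ? [? ? ?]] := neqs.
by rewrite /t tpermL tpermR !tpermD // eq_sym.
Qed.

Lemma column_groupE : column_group n lam =i [:: 1%g; s; t; (s * t)%g].
Proof.
have [s0 s1 sp sq] := sE; have [t0 t1 tp tq] := tE.
move=> g; apply/idP/idP => [gC|]; last first.
  rewrite !in_cons in_nil orbF => /or4P[] /eqP-> //; last exact: column_groupM.
  by rewrite inE; apply/forallP=> i; rewrite perm1.
have c0 : g o0 = o0 \/ g o0 = p.
  have := column_group_mem o0 gC; rewrite !tab_colE.
  have := ltn_ord (g o0); rewrite /o0 /p /= => gn; case: leqP => ?; case: leqP => ? ?;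
    by [left; apply: val_inj => /=; lia | right; apply: val_inj => /=; lia].
have c1 : g o1 = o1 \/ g o1 = q.
  have := column_group_mem o1 gC; rewrite !tab_colE.
  have := ltn_ord (g o1); rewrite /o1 /q /= => gn; case: leqP => ?; case: leqP => ? ?;
    by [left; apply: val_inj => /=; lia | right; apply: val_inj => /=; lia].
have ss : (s * s = 1)%g by apply: tperm2.
have tt : (t * t = 1)%g by apply: tperm2.
rewrite !inE; case: c0 => g0; case: c1 => g1.
- by rewrite (column_group_fix gC g0 g1) eqxx.
- suff /eqP : (g * t)%g = 1%g by rewrite -(inj_eq (mulIg t)) -mulgA tt mulg1 mul1g => ->;
    rewrite !orbT.
  by apply: column_group_fix; rewrite ?column_groupM // permM ?g0 ?g1.
- suff /eqP : (g * s)%g = 1%g by rewrite -(inj_eq (mulIg s)) -mulgA ss mulg1 mul1g => ->;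
    rewrite !orbT.
  by apply: column_group_fix; rewrite ?column_groupM // permM ?g0 ?g1.
(* Here g exchanges the two entries in both columns. *)
suff /eqP : (g * t * s)%g = 1%g.
  rewrite -(inj_eq (mulIg s)) -mulgA ss mulg1 mul1g -(inj_eq (mulIg t)) -mulgA tt mulg1 => ->.
  by rewrite !orbT.
by apply: column_group_fix; rewrite ?column_groupM // !permM ?g0 ?g1 ?tp ?tq.
Qed.

(** The column group has four elements, generated by the transpositions of the
    two columns of length 2, and the signs are those of the 4-cycle. *)
Lemma polytabloid_form : Theta u0 = cross_mx F p q o0 o1.
Proof.
have [s0 s1 sp sq] := sE; have [t0 t1 tp tq] := tE.
have us : uniq [:: 1%g; s; t; (s * t)%g].
  apply: (@map_uniq _ _ (fun g : 'S_n => (g p, g q))).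
  rewrite /= !permM !perm1 sp sq tp tq t0.
  have [pq p0 p1 [q0 q1 o01]] := neqs.
  rewrite !inE !xpair_eqE.
  by rewrite (negbTE p0) (negbTE q1) !andbF.
rewrite /polytabloid linear_sum /= (eq_bigl _ _ column_groupE) -big_uniq //=.
rewrite !big_cons big_nil addr0 !linearZ /= -/f0 !tabloid_vec_form.
rewrite !tabloid_formJ canonical_tabloid_form !edge_mxJ.
rewrite !permM !perm1 sp sq tp tq t0 odd_permM odd_perm1 !odd_tperm.
have [pq p0 p1 [q0 q1 o01]] := neqs.
rewrite [o0 == p]eq_sym p0 [o1 == q]eq_sym q1 /=.
by rewrite expr0 expr1 !scaleN1r !scale1r /cross_mx !addrA.
Qed.

Lemma specht_form x : (x <= cyclic_mx (tabloid_repr F n lam) u0)%MS -> is_edge_form (Theta x).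
Proof.
move=> /cyclic_mx_span[c ->]; rewrite linear_sum /=.
have eD (X Y : 'M[F]_n) : is_edge_form X -> is_edge_form Y -> is_edge_form (X + Y).
  move=> [Xz Xt Xd] [Yz Yt Yd]; split; first exact: zero_sumD.
    by rewrite linearD /= Xt Yt.
  by move=> i; rewrite mxE Xd Yd addr0.
have eZ a (X : 'M[F]_n) : is_edge_form X -> is_edge_form (a *: X).
  move=> [Xz Xt Xd]; split; first exact: zero_sumZ.
    by rewrite linearZ /= Xt.
  by move=> i; rewrite mxE Xd mulr0.
elim/big_ind: _ => [|X Y|g _]; [|exact: eD|].
  by rewrite -(scale0r (cross_mx F p q o0 o1)); apply/eZ/cross_mx_edge/upq.
rewrite linearZ /=; apply: eZ.
rewrite tabloid_space_formJ polytabloid_form cross_mxJ; apply: cross_mx_edge.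
have := upq; rewrite -(map_inj_uniq (@perm_inj _ g)); exact: id.
Qed.

(** The Specht module lies in the span of the tabloids of shape (n-2, 2), and
    the coefficient of such a tabloid is the entry of the matrix at the two
    elements of its second row. *)
Lemma specht_form_eq0 x :
  (x <= cyclic_mx (tabloid_repr F n lam) u0)%MS -> Theta x = 0 -> x = 0.
Proof.
move=> xu x0; have [c xE] : exists c : 'S_n -> F, x = \sum_(g in [set: 'S_n]%G)
    c g *: (tabloid_vec f0 *m tabloid_repr F n lam g).
  apply: cyclic_mx_span; apply: submx_trans xu _.
  apply: cyclic_mx_sub; first exact: cyclic_mx_module.
  apply: summx_sub => g _; apply: scalemx_sub.
  rewrite -tabloid_mxE -[tabloid_mx _ _ _]/(tabloid_repr F n lam g).
  by apply: mxmodule_trans; rewrite ?cyclic_mx_module ?in_setT ?cyclic_mx_id.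
have pq : p != q by rewrite -val_eqE /=; lia.
have actE f (g : 'S_n) i : tabloid_act f g i = f (g^-1 i)%g by rewrite ffunE.
have shape (g h : 'S_n) : tabloid_form (tabloid_act f0 g) (h p) (h q) =
    (tabloid_act f0 g == tabloid_act f0 h)%:R.
  rewrite mxE (inj_eq perm_inj) pq andTb !actE !canonical_tabloid1.
  congr (nat_of_bool _)%:R; apply/idP/eqP => [|e]; last first.
    by rewrite -!canonical_tabloid1 -!actE e !actE !permK !canonical_tabloid1 !inE !eqxx orbT.
  rewrite -!permM; set k := (h * g^-1)%g => /andP[kp kq].
  apply/ffunP=> l; apply: val_inj; rewrite !actE /= !canonical_tabloidE.
  rewrite -[l](permKV h) permK -permM -/k; move: (h^-1 l)%g => j; congr nat_of_bool.
  have kE z y : k z = y -> (k j == y) = (j == z).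
    by move=> <-; rewrite (inj_eq perm_inj).
  (* k maps {p, q} to itself, either fixing or exchanging its elements. *)
  have kpq : k p != k q by rewrite (inj_eq perm_inj).
  move: kp kq; rewrite !inE  => /orP[] /eqP kp /orP[] /eqP kq.
  - by rewrite kp kq eqxx in kpq.
  - by rewrite (kE _ _ kp) (kE _ _ kq).
  - by rewrite (kE _ _ kp) (kE _ _ kq) orbC.
  - by rewrite kp kq eqxx in kpq.
apply/rowP=> k; rewrite mxE.
have xkE : x 0 k = \sum_(g in [set: 'S_n]%G) c g * (tabloid_act f0 g == enum_val k)%:R.
  rewrite {1}xE summxE; apply: eq_bigr => g _; rewrite mxE; congr (_ * _).
  rewrite [_ *m _]tabloid_mxE mxE eqxx /= -(inj_eq enum_val_inj) enum_rankK eq_sym.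
  by [].
have [/existsP[h /eqP hk]|/existsPn nok] := boolP [exists h, tabloid_act f0 h == enum_val k].
  rewrite xkE -hk; transitivity (Theta x (h p) (h q)); last by rewrite x0 mxE.
  rewrite {1}xE linear_sum summxE /=; apply: eq_bigr => g _.
  rewrite linearZ /= mxE; congr (_ * _).
  by rewrite tabloid_space_formJ tabloid_vec_form -tabloid_formJ shape.
by rewrite xkE big1 // => g _; rewrite (negbTE (nok g)) mulr0.
Qed.

(** The 4-cycles are the images of the translates of the polytabloid, as any four
    distinct vertices are images of p, q, o0, o1 by a permutation. *)
Lemma specht_form_surj Z : is_edge_form Z ->
  exists2 x, (x <= cyclic_mx (tabloid_repr F n lam) u0)%MS & Theta x = Z.
Proof.
move=> Ze; pose U := cyclic_mx (tabloid_repr F n lam) u0.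
pose img Z := exists2 x, (x <= U)%MS & Theta x = Z.
have img0 : img 0 by exists 0; rewrite ?sub0mx ?linear0.
have imgD X Y : img X -> img Y -> img (X + Y).
  by move=> [x xU <-] [y yU <-]; exists (x + y); rewrite ?addmx_sub ?linearD.
have imgZ a X : img X -> img (a *: X).
  by move=> [x xU <-]; exists (a *: x); rewrite ?scalemx_sub ?linearZ.
have img_cross a b c d : uniq [:: a; b; c; d] -> img (cross_mx F a b c d).
  move=> abcd; have [g [<- <- <- <-]] := perm_of_uniq upq abcd erefl.
  exists (u0 *m tabloid_repr F n lam g).
    by apply: mxmodule_trans; rewrite ?cyclic_mx_module ?in_setT ?cyclic_mx_id.
  by rewrite tabloid_space_formJ polytabloid_form cross_mxJ.
have k0 : 2 * m%:R * (m%:R - 1) != 0 :> F.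
  rewrite !mulf_neq0 ?pnatr_eq0 //; first by lia.
  by rewrite subr_eq0 pnatr_eq1; lia.
rewrite -/(img Z) -[Z]scale1r -(mulVf k0) -scalerA -edge_form_average //.
apply: (imgZ); do 4!apply: (big_ind img) => // ? _.
case: (boolP (uniq _)) => [abcd|_]; first by apply/imgZ/img_cross.
by rewrite mul0r scale0r.
Qed.

End SpechtModule.

Section Conclusion.
Variables (F : numFieldType) (m : nat).
Hypothesis m_gt2 : (2 < m)%N.
Local Notation n := m.+1.
Local Notation lam := [:: (n - 2)%N; 2%N].
Local Notation U := (cyclic_mx (tabloid_repr F n lam) (polytabloid F n lam)).

Lemma conj_repr_specht :
  mx_rsim (conj_repr F m)
    (dadd_grepr (Representation (standard_repr F n))
       (dadd_grepr (Representation (exterior2_repr (standard_repr F n)))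
          (Representation (specht_repr F n lam)))).
Proof.
pose f : {linear 'rV[F]_(\rank U) -> 'M[F]_n} :=
  @tabloid_space_form F m \o @val_submod F _ U 1.
have fE u : f u = tabloid_space_form (val_submod u) by [].
apply: (@conj_repr_decomposition F m _ _ (specht_repr F n lam) f).
- exact: ltnW.
- move=> u g; rewrite !fE (val_submodJ (cyclic_mx_module _ _) _ (in_setT g)).
  exact: tabloid_space_formJ.
- by move=> u; rewrite fE; apply: specht_form (val_submodP u).
- move=> u; rewrite fE => /(specht_form_eq0 m_gt2 (val_submodP u))/eqP.
  by rewrite val_submod_eq0 => /eqP.
move=> Z /(specht_form_surj m_gt2)[x xU <-].
by exists (in_submod U x); rewrite fE in_submodK.
Qed.

End Conclusion.

Local Close Scope ring_scope.

Theorem theorem2p2 (R : realType) :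
  (forall n : nat, (4 <= n)%N ->
     exists rhoS : mx_representation R[i] [set: 'S_n]%G (\dim (sl R[i] n.-1)),
       (forall b : braid n, rhoS (braid_perm b) = rho 1%R b) /\
       mx_rsim rhoS
         (dadd_grepr (Representation (standard_repr R[i] n))
           (dadd_grepr
             (Representation (exterior2_repr (standard_repr R[i] n)))
             (Representation (specht_repr R[i] n [:: (n - 2)%N; 2]))))) /\
  (exists rhoS : mx_representation R[i] [set: 'S_3]%G (\dim (sl R[i] 3.-1)),
     (forall b : braid 3, rhoS (braid_perm b) = rho 1%R b) /\
     mx_rsim rhoS
       (dadd_grepr (Representation (standard_repr R[i] 3))
         (Representation (exterior2_repr (standard_repr R[i] 3))))).
Proof.
split=> [[|m] // m_gt2|].
  by exists (conj_repr R[i] m); split; [apply: conj_mx_rho | apply: conj_repr_specht].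
exists (conj_repr R[i] 2); split; first exact: conj_mx_rho.
by apply: conj_repr_decomposition0 => //; apply: edge_form3_eq0.
Qed.
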